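(* Let $k$ be a field of characteristic $p>0$ with $[k:k^p]<\infty$, let $S=k[x_0,\dots,x_n]$ with the standard grading, and let $\mathfrak{m}=(x_0,\dots,x_n)$. Let $J=(f_1,\dots,f_c)\subseteq S$ be an ideal generated by a homogeneous regular sequence $f_1,\dots,f_c$, put $R=S/J$ and $d=\sum_{j=1}^c\deg(f_j)$. Let $\tau$ be the smallest ideal of $S$ such that $J\subseteq\tau$ and $(f_1\cdots f_c)^{p-1}\in\tau^{[p]}$, and assume $\tau\neq S$. Then $\sqrt{\tau}=\mathfrak{m}$ if and only if the Frobenius action $$F: H^{n+1-c}_{\mathfrak{m}}(R)_{<-(n+1-c)d}\to H^{n+1-c}_{\mathfrak{m}}(R)_{<-p(n+1-c)d}$$ is injective.
   Context: For an ideal $I$ of $S$, $I^{[p]}=(a^p\mid a\in I)$ is the ideal generated by the $p$-th powers of elements of $I$. For a graded module $M$, $M_{<t}$ denotes $\bigoplus_{s<t}M_s$. The elements of the homogeneous regular sequence are homogeneous forms of positive degree. $H^i_{\mathfrak{m}}(R)$ is the $\mathbb{Z}$-graded local cohomology of $R$ with support in $\mathfrak{m}$, and the Frobenius action $F$ on it is the additive map induced by the Frobenius homomorphism $r\mapsto r^p$ of $R$; it sends elements of degree $t$ to elements of degree $pt$. *)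

(* Defs.v *)
From HB Require Import structures.
From mathcomp Require Import all_boot all_order all_algebra.
From mathcomp Require Import ring_quotient boolp mpoly zify.

Set Implicit Arguments.
Unset Strict Implicit.
Unset Printing Implicit Defensive.

Import Order.TTheory GRing.Theory Num.Theory.

Local Open Scope ring_scope.
Local Open Scope quotient_scope.

Section Ideals.
Variable S : comNzRingType.

Definition is_ideal (I : S -> Prop) : Prop :=
  [/\ I 0, forall a b, I a -> I b -> I (a + b) & forall r a, I a -> I (r * a)].

Definition ideal_gen (X : S -> Prop) (g : S) : Prop :=
  exists (r : nat) (a b : 'I_r -> S),
    (forall l, X (b l)) /\ g = \sum_l a l * b l.

Definition is_smallest (P : (S -> Prop) -> Prop) (tau : S -> Prop) : Prop :=
  P tau /\ forall I, P I -> forall g, tau g -> I g.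

Definition frob_power (p : nat) (I : S -> Prop) : S -> Prop :=
  ideal_gen (fun b => exists2 a, I a & b = a ^+ p).

Definition radical (I : S -> Prop) (g : S) : Prop := exists N, I (g ^+ N).

Definition regular_seq (c : nat) (f : 'I_c -> S) : Prop :=
  (forall (i : 'I_c) (g : S),
     let I := ideal_gen (fun h => exists2 j : 'I_c, (j < i)%N & h = f j) in
     I (g * f i) -> I g)
  /\ ~ ideal_gen (fun h => exists j, h = f j) 1.

End Ideals.

(* The localization R_f: classes of pairs (a, N), read as a / f ^ N.          *)
(* R_f is the zero ring when f is nilpotent, hence comPzRingType.             *)
Section Localization.
Variables (R : comPzRingType) (f : R).

Definition loc_rel (u v : R * nat) : bool :=
  `[< exists L, f ^+ (L + v.2) * u.1 = f ^+ (L + u.2) * v.1 >].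

Lemma loc_rel_equiv : equiv_class_of loc_rel.
Proof.
split=> [u|u v|v u w]; first by apply/asboolP; exists 0%N.
- by apply/asboolP/asboolP=> -[L e]; exists L.
move=> /asboolP[L e] /asboolP[L' e']; apply/asboolP; exists (L + L' + v.2)%N.
have -> : (L + L' + v.2 + w.2 = (L' + w.2) + (L + v.2))%N by lia.
have -> : (L + L' + v.2 + u.2 = (L + u.2) + (L' + v.2))%N by lia.
by rewrite [in LHS]exprD -mulrA e mulrCA e' mulrA -exprD.
Qed.

Canonical loc_rel_equivRel := EquivRelPack loc_rel_equiv.
Canonical loc_rel_encModRel := defaultEncModRel loc_rel.

Definition loc := {eq_quot loc_rel}.
HB.instance Definition _ : EqQuotient _ loc_rel loc := EqQuotient.on loc.
HB.instance Definition _ := Choice.on loc.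

Definition frac (a : R) (N : nat) : loc := \pi_loc (a, N).

Lemma fracP a N b M :
  frac a N = frac b M <-> exists L, f ^+ (L + M) * a = f ^+ (L + N) * b.
Proof.
split=> [/eqmodP/asboolP //|h]; apply/eqmodP; exact/asboolP.
Qed.

Lemma fracE (x : loc) : x = frac (repr x).1 (repr x).2.
Proof. by rewrite /frac -surjective_pairing reprK. Qed.

Lemma fracW (P : loc -> Prop) : (forall a N, P (frac a N)) -> forall x, P x.
Proof. by move=> h x; rewrite (fracE x). Qed.

Definition loc_add (x y : loc) : loc :=
  frac (f ^+ (repr y).2 * (repr x).1 + f ^+ (repr x).2 * (repr y).1)
       ((repr x).2 + (repr y).2).
Definition loc_opp (x : loc) : loc := frac (- (repr x).1) (repr x).2.
Definition loc_mul (x y : loc) : loc :=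
  frac ((repr x).1 * (repr y).1) ((repr x).2 + (repr y).2).

Lemma repr_frac a N :
  exists L, f ^+ (L + N) * (repr (frac a N)).1 = f ^+ (L + (repr (frac a N)).2) * a.
Proof. by apply/fracP; rewrite -fracE. Qed.

Lemma loc_addE a N b M :
  loc_add (frac a N) (frac b M) = frac (f ^+ M * a + f ^+ N * b) (N + M).
Proof.
rewrite /loc_add; set x := frac a N; set y := frac b M.
have [L e] := repr_frac a N; have [L' e'] := repr_frac b M.
rewrite -/x -/y in e e' *; case: (repr x) e => u n /= e.
case: (repr y) e' => v m /= e'; apply/fracP; exists (L + L')%N.
rewrite !mulrDr; congr (_ + _).
  transitivity (f ^+ (L' + M + m) * (f ^+ (L + N) * u)).
    by rewrite !mulrA -!exprD; congr (f ^+ _ * _); lia.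
  by rewrite e !mulrA -!exprD; congr (f ^+ _ * _); lia.
transitivity (f ^+ (L + N + n) * (f ^+ (L' + M) * v)).
  by rewrite !mulrA -!exprD; congr (f ^+ _ * _); lia.
by rewrite e' !mulrA -!exprD; congr (f ^+ _ * _); lia.
Qed.

Lemma loc_oppE a N : loc_opp (frac a N) = frac (- a) N.
Proof.
have [L e] := repr_frac a N; apply/fracP; exists L.
by rewrite !mulrN e.
Qed.

Lemma loc_mulE a N b M : loc_mul (frac a N) (frac b M) = frac (a * b) (N + M).
Proof.
rewrite /loc_mul; set x := frac a N; set y := frac b M.
have [L e] := repr_frac a N; have [L' e'] := repr_frac b M.
rewrite -/x -/y in e e' *; case: (repr x) e => u n /= e.
case: (repr y) e' => v m /= e'; apply/fracP; exists (L + L')%N.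
transitivity ((f ^+ (L + N) * u) * (f ^+ (L' + M) * v)).
  by rewrite mulrACA -exprD; congr (f ^+ _ * _); lia.
by rewrite e e' mulrACA -exprD; congr (f ^+ _ * _); lia.
Qed.

Lemma frac_shift L a N : frac (f ^+ L * a) (L + N) = frac a N.
Proof. by apply/fracP; exists 0%N; rewrite mulrA -exprD addnC. Qed.

Lemma loc_addA : associative loc_add.
Proof.
elim/fracW=> a N; elim/fracW=> b M; elim/fracW=> c K.
rewrite !loc_addE addnA; congr frac.
by rewrite !mulrDr !mulrA -!exprD addrA [(K + M)%N]addnC [(K + N)%N]addnC.
Qed.

Lemma loc_addC : commutative loc_add.
Proof.
by elim/fracW=> a N; elim/fracW=> b M; rewrite !loc_addE addrC addnC.
Qed.

Lemma loc_add0 : left_id (frac 0 0) loc_add.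
Proof. by elim/fracW=> a N; rewrite loc_addE mulr0 add0r expr0 mul1r. Qed.

Lemma loc_addN : left_inverse (frac 0 0) loc_opp loc_add.
Proof.
elim/fracW=> a N; rewrite loc_oppE loc_addE mulrN addNr.
by apply/fracP; exists 0%N; rewrite !mulr0.
Qed.

HB.instance Definition _ :=
  GRing.isZmodule.Build loc loc_addA loc_addC loc_add0 loc_addN.

Lemma loc_mulA : associative loc_mul.
Proof.
by elim/fracW=> a N; elim/fracW=> b M; elim/fracW=> c K;
  rewrite !loc_mulE mulrA addnA.
Qed.

Lemma loc_mulC : commutative loc_mul.
Proof.
by elim/fracW=> a N; elim/fracW=> b M; rewrite !loc_mulE mulrC addnC.
Qed.

Lemma loc_mul1 : left_id (frac 1 0) loc_mul.
Proof. by elim/fracW=> a N; rewrite loc_mulE mul1r. Qed.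

Lemma loc_mulDl : left_distributive loc_mul loc_add.
Proof.
elim/fracW=> a N; elim/fracW=> b M; elim/fracW=> c K.
rewrite !(loc_addE, loc_mulE) -(frac_shift K (_ * c)).
rewrite !mulrDl !mulrDr !mulrA -!exprD [(K + M)%N]addnC [(K + N)%N]addnC.
by congr frac; lia.
Qed.

HB.instance Definition _ :=
  GRing.Zmodule_isComPzRing.Build loc loc_mulA loc_mulC loc_mul1 loc_mulDl.

Lemma fracD a N b M :
  frac a N + frac b M = frac (f ^+ M * a + f ^+ N * b) (N + M).
Proof. exact: loc_addE. Qed.

Lemma fracN a N : - frac a N = frac (- a) N.
Proof. exact: loc_oppE. Qed.

Lemma fracM a N b M : frac a N * frac b M = frac (a * b) (N + M).
Proof. exact: loc_mulE. Qed.

Lemma fracX a N p : frac a N ^+ p = frac (a ^+ p) (N * p).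
Proof.
elim: p => [|p ih]; first by rewrite !expr0 muln0.
by rewrite exprS ih fracM -exprS mulnS.
Qed.

Lemma loc_natr0 (p : nat) : p%:R = 0 :> R -> p%:R = 0 :> loc.
Proof.
have h q : q%:R = frac q%:R 0.
  elim: q => [//|q ih].
  have e1 : 1 = frac 1 0 :> loc by [].
  by rewrite -!natr1 ih e1 fracD !expr0 !mul1r.
by move=> p0; rewrite h p0.
Qed.

End Localization.

Lemma pFrobeniusD (R : comPzRingType) (p : nat) :
  prime p -> p%:R = 0 :> R -> {morph (fun x : R => x ^+ p) : x y / x + y}.
Proof.
move=> p_pr p0 x y; rewrite exprDn; case: p p_pr p0 => // q p_pr p0.
rewrite big_ord_recl big_ord_recr /= subn0 subnn !expr0 mulr1 mul1r.
rewrite bin0 binn !mulr1n big1 ?add0r // => i _.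
have /dvdnP[z ->] : (q.+1 %| 'C(q.+1, bump 0 i))%N.
  by apply: prime_dvd_bin; rewrite // /bump /= add1n ltnS ltn_ord.
by rewrite mulrnA -mulr_natl p0 mul0r.
Qed.

(* The Cech complex of R on x_0, ..., x_(m-1), the direct sum over the        *)
(* subsets A of {0, ..., m-1} of the rings R_(x_A), x_A the product of the    *)
(* x_j for j in A; the summands with #|A| = i form the term of degree i.      *)
(* Its i-th cohomology is the local cohomology of R with support in           *)
(* (x_0, ..., x_(m-1)).                                                       *)
Section Cech.
Variables (R : comPzRingType) (m : nat) (x : 'I_m -> R).
Implicit Types (A B : {set 'I_m}) (i : nat).

Definition xprod A : R := \prod_(j in A) x j.

(* For A \subset B, the localization map a / x_A^N |-> a x_(B\A)^N / x_B^N.   *)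
Definition cech_res A B (u : loc (xprod A)) : loc (xprod B) :=
  frac (xprod B) ((repr u).1 * xprod (B :\: A) ^+ (repr u).2) (repr u).2.

Definition cech := {dffun forall A : {set 'I_m}, loc (xprod A)}.
HB.instance Definition _ := Choice.on cech.

Definition cech_add (c e : cech) : cech := [ffun A => c A + e A].
Definition cech_opp (c : cech) : cech := [ffun A => - c A].
Definition cech_zero : cech := [ffun A => 0].

Lemma cech_addA : associative cech_add.
Proof. by move=> c e g; apply/ffunP=> A; rewrite !ffunE addrA. Qed.
Lemma cech_addC : commutative cech_add.
Proof. by move=> c e; apply/ffunP=> A; rewrite !ffunE addrC. Qed.
Lemma cech_add0 : left_id cech_zero cech_add.
Proof. by move=> c; apply/ffunP=> A; rewrite !ffunE add0r. Qed.
Lemma cech_addN : left_inverse cech_zero cech_opp cech_add.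
Proof. by move=> c; apply/ffunP=> A; rewrite !ffunE addNr. Qed.

HB.instance Definition _ :=
  GRing.isZmodule.Build cech cech_addA cech_addC cech_add0 cech_addN.

Definition cech_d (c : cech) : cech :=
  [ffun B : {set 'I_m} => \sum_(j in B)
     (-1) ^+ #|[set l in B | (l < j)%N]| * cech_res B (c (B :\ j))].

Definition in_degree i (c : cech) : bool :=
  [forall A : {set 'I_m}, (#|A| != i) ==> (c A == 0)].

Lemma xprodS A B : A \subset B -> xprod B = xprod A * xprod (B :\: A).
Proof.
move=> sAB; rewrite /xprod (big_setID A) /=; congr (_ * _).
by rewrite (setIidPr sAB).
Qed.

Lemma cech_resE A B a N : A \subset B ->
  cech_res B (frac (xprod A) a N) = frac (xprod B) (a * xprod (B :\: A) ^+ N) N.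
Proof.
move=> /xprodS eB; rewrite /cech_res; set u := frac _ a N.
have [L] := repr_frac (xprod A) a N; rewrite -/u.
case: (repr u) => b M /= e; apply/fracP; exists L.
rewrite eB !exprMn; set f := xprod A in e *; set g := xprod _.
transitivity (f ^+ (L + N) * b * (g ^+ (L + N) * g ^+ M)).
  by rewrite -!mulrA; congr (_ * _); rewrite mulrCA.
rewrite e -!mulrA; congr (_ * _); rewrite [RHS]mulrCA; congr (_ * _).
by rewrite -!exprD; congr (g ^+ _); lia.
Qed.

Lemma cech_resD A B : A \subset B ->
  {morph @cech_res A B : u v / u + v}.
Proof.
move=> sAB; elim/fracW=> a N; elim/fracW=> b M.
rewrite fracD !cech_resE // fracD; congr frac.
rewrite (xprodS sAB) !exprMn mulrDl exprD; congr (_ + _); last first.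
  by rewrite -!mulrA; congr (_ * _); rewrite mulrCA.
rewrite -!mulrA; congr (_ * _).
by rewrite [RHS]mulrCA; congr (_ * _); rewrite mulrC.
Qed.

Lemma cech_resX A B p : A \subset B ->
  {morph @cech_res A B : u / u ^+ p}.
Proof.
move=> sAB; elim/fracW=> a N.
by rewrite fracX !cech_resE // fracX exprMn exprM.
Qed.

Lemma cech_resN A B : A \subset B -> {morph @cech_res A B : u / - u}.
Proof. by move=> sAB; elim/fracW=> a N; rewrite fracN !cech_resE // fracN mulNr. Qed.

Lemma cech_dB : {morph cech_d : c e / c - e}.
Proof.
move=> c e; apply/ffunP=> B; rewrite !ffunE -sumrB; apply: eq_bigr => j jB.
by rewrite !ffunE cech_resD ?cech_resN ?subD1set // mulrDr mulrN.
Qed.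

HB.instance Definition _ := GRing.isZmodMorphism.Build cech cech cech_d cech_dB.

Lemma cech_resM A B : A \subset B ->
  {morph @cech_res A B : u v / u * v}.
Proof.
move=> sAB; elim/fracW=> a N; elim/fracW=> b M.
by rewrite fracM !cech_resE // fracM mulrACA exprD.
Qed.

Lemma cech_res1 A B : A \subset B -> cech_res B (1 : loc (xprod A)) = 1.
Proof. by move=> sAB; rewrite [LHS]cech_resE // expr0 mulr1. Qed.

Lemma cech_res_comp A B (D : {set 'I_m}) (u : loc (xprod A)) : A \subset B -> B \subset D ->
  cech_res D (cech_res B u) = cech_res D u.
Proof.
move=> sAB sBD; elim/fracW: u => a N.
rewrite !cech_resE ?(subset_trans sAB) // -mulrA -exprMn; congr (frac _ (_ * _ ^+ _) _).
rewrite /xprod [RHS](big_setID B) /=; congr (_ * _); apply: eq_bigl => j.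
  by rewrite !inE; case jB: (j \in B); rewrite ?(subsetP sBD _ jB) ?andbT ?andbF.
rewrite !inE; case jB: (j \in B) => //=.
by case jA: (j \in A) => //=; rewrite (subsetP sAB _ jA) in jB.
Qed.

Lemma cech_d2 c : cech_d (cech_d c) = 0.
Proof.
apply/ffunP=> B; rewrite !ffunE.
pose sg (A : {set 'I_m}) (j : 'I_m) := #|[set l in A | (l < j)%N]|.
pose T j l := (-1) ^+ (sg B j + sg (B :\ j) l) *
  cech_res B (c (B :\ j :\ l)) : loc (xprod B).
have -> : \sum_(j in B) (-1) ^+ sg B j * cech_res B (cech_d c (B :\ j)) =
    \sum_(j in B) \sum_(l in B | l != j) T j l.
  apply: eq_bigr => j jB; rewrite ffunE.
  have sB : B :\ j \subset B by exact: subD1set.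
  have res0 : cech_res B (0 : loc (xprod (B :\ j))) = 0.
    by apply: (addrI (cech_res B (0 : loc (xprod (B :\ j))))); rewrite -cech_resD ?addr0.
  rewrite (big_morph _ (cech_resD sB) res0) mulr_sumr.
  apply: eq_big => [l|l _]; first by rewrite !inE andbC.
  have resN1 e : cech_res B ((-1) ^+ e : loc (xprod (B :\ j))) = (-1) ^+ e.
    by rewrite cech_resX // cech_resN // cech_res1.
  by rewrite cech_resM // resN1 cech_res_comp ?subD1set // mulrA -exprD.
have Tsym j l : j \in B -> l \in B -> (l < j)%N -> T j l = - T l j.
  move=> jB lB ltlj; have eS : B :\ j :\ l = B :\ l :\ j by rewrite !setDDl setUC.
  rewrite /T eS -mulNr.
  congr (_ * _); rewrite -[RHS]mulN1r -exprS; congr (_ ^+ _).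
  have -> : sg (B :\ j) l = sg B l.
    apply: eq_card => q; rewrite !inE; case: eqP => [->|] //=.
    by rewrite ltnNge ltnW // andbF.
  have -> : sg B j = (sg (B :\ l) j).+1.
    rewrite /sg (cardsD1 l) !inE lB ltlj add1n; congr _.+1.
    by apply: eq_card => q; rewrite !inE andbA.
  by rewrite addSn [(sg B l + _)%N]addnC.
have -> : \sum_(j in B) \sum_(l in B | l != j) T j l =
    \sum_(j in B) \sum_(l in B | (l < j)%N) T j l
    + \sum_(j in B) \sum_(l in B | (j < l)%N) T j l.
  rewrite -big_split; apply: eq_bigr => j jB /=.
  rewrite (bigID (fun l : 'I_m => (l < j)%N)) /=; congr (_ + _); apply: eq_bigl => l.
    by rewrite -andbA -val_eqE /=; case: ltngtP; rewrite ?andbF.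
  by rewrite -andbA -val_eqE /=; case: ltngtP; rewrite ?andbF.
rewrite [X in _ + X](exchange_big_dep (mem B)) /=; last by move=> j l _ /andP[].
rewrite -big_split big1 // => j jB /=.
rewrite [X in _ + X](eq_bigl (fun l => (l \in B) && (l < j)%N)); last first.
  by move=> l; rewrite jB.
rewrite -big_split big1 // => l /andP[lB lj] /=.
by rewrite (Tsym j l) // addNr.
Qed.

Lemma in_degree_zmod i : zmod_closed (in_degree i).
Proof.
split=> [|c e /forallP hc /forallP he]; apply/forallP=> A; apply/implyP=> hA.
  by rewrite ffunE.
by rewrite !ffunE (eqP (implyP (hc A) hA)) (eqP (implyP (he A) hA)) subrr.
Qed.

Definition cocycle_pred i : pred cech :=
  fun c => in_degree i c && (cech_d c == 0).

Lemma cocycle_zmod i : zmod_closed (cocycle_pred i).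
Proof.
have [h0 hB] := in_degree_zmod i.
split=> [|c e /andP[hc /eqP dc] /andP[he /eqP de]]; apply/andP; split.
- exact: h0.
- by rewrite raddf0.
- exact: hB.
by rewrite raddfB /= dc de subrr.
Qed.

HB.instance Definition _ i :=
  GRing.isZmodClosed.Build cech (cocycle_pred i) (cocycle_zmod i).

Record cocycle i := Cocycle {cocycle_val :> cech; _ : cocycle_pred i cocycle_val}.
HB.instance Definition _ i := [isSub for @cocycle_val i].
HB.instance Definition _ i := [Choice of cocycle i by <:].
HB.instance Definition _ i := [SubChoice_isSubZmodule of cocycle i by <:].

(* in degree i = 0 this leaves b = 0 only *)
Definition coboundary i : pred (cocycle i) :=
  fun z => `[< exists2 b : cech,
    [forall A : {set 'I_m}, (#|A|.+1 != i) ==> (b A == 0)] & val z = cech_d b >].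

Lemma coboundary_zmod i : zmod_closed (@coboundary i).
Proof.
split=> [|z w /asboolP[b hb zb] /asboolP[e he we]]; apply/asboolP.
  exists 0; last by rewrite !raddf0.
  by apply/forallP=> A; apply/implyP=> _; rewrite ffunE.
exists (b - e); last by rewrite !raddfB /= zb we.
apply/forallP=> A; apply/implyP=> hA.
by rewrite !ffunE (eqP (implyP (forallP hb A) hA)) (eqP (implyP (forallP he A) hA)) subrr.
Qed.

HB.instance Definition _ i :=
  GRing.isZmodClosed.Build (cocycle i) (@coboundary i) (@coboundary_zmod i).

Definition coboundaries i : zmodClosed (cocycle i) :=
  GRing.ZmodClosed.clone (cocycle i) (@coboundary i) _.

Definition local_cohomology i := Quotient.quot (coboundaries i).
HB.instance Definition _ i := GRing.Zmodule.on (local_cohomology i).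

Definition coh_class i (z : cocycle i) : local_cohomology i :=
  \pi_(local_cohomology i) z.

Lemma coh_classB i : {morph @coh_class i : z w / z - w}.
Proof. by move=> z w; rewrite /coh_class raddfB. Qed.

HB.instance Definition _ i := GRing.isZmodMorphism.Build
  (cocycle i) (local_cohomology i) (@coh_class i) (@coh_classB i).

Lemma coh_class0P i (z : cocycle i) : coh_class z = 0 <-> coboundary z.
Proof.
rewrite -(raddf0 (@coh_class i)) -{2}[z]subr0.
by split=> [/eqmodP //|h]; apply/eqmodP.
Qed.

Lemma coh_classE i (h : local_cohomology i) : h = coh_class (repr h).
Proof. by rewrite /coh_class reprK. Qed.

(* The Frobenius action: the p-th power map on each R_(x_A).                  *)
Section Frobenius.
Variables (p : nat) (p_prime : prime p) (p0 : p%:R = 0 :> R).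

Definition cech_frob (c : cech) : cech :=
  [ffun A : {set 'I_m} => c A ^+ p].

Let expp0 (L : comPzRingType) : (0 : L) ^+ p = 0.
Proof. by rewrite expr0n gtn_eqF ?prime_gt0. Qed.

Lemma cech_frobD : {morph cech_frob : c e / c + e}.
Proof.
move=> c e; apply/ffunP=> A; rewrite !ffunE.
exact: (pFrobeniusD p_prime (loc_natr0 _ p0)).
Qed.

Lemma cech_frob0 : cech_frob 0 = 0.
Proof. by apply/ffunP=> A; rewrite !ffunE expp0. Qed.

Lemma cech_frobB : {morph cech_frob : c e / c - e}.
Proof.
by move=> c e; apply/eqP; rewrite eq_sym subr_eq -cech_frobD subrK.
Qed.

Lemma cech_frob_d c : cech_d (cech_frob c) = cech_frob (cech_d c).
Proof.
apply/ffunP=> B; rewrite !ffunE.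
have pL : p%:R = 0 :> loc (xprod B) by exact: loc_natr0.
have Dp := pFrobeniusD p_prime pL.
rewrite (big_morph _ Dp (expp0 _)); apply: eq_bigr => j jB.
rewrite !ffunE cech_resX ?subD1set // exprMn; congr (_ * _).
rewrite -exprM mulnC exprM; congr (_ ^+ _).
by apply/eqP; rewrite eq_sym -addr_eq0 -[X in _ + X](expr1n _ p) -Dp addNr expp0.
Qed.

Lemma cech_frob_cocycle i (z : cocycle i) : cocycle_pred i (cech_frob z).
Proof.
have /andP[/forallP hz /eqP dz] := valP z; apply/andP; split; last first.
  by rewrite cech_frob_d dz cech_frob0.
apply/forallP=> A; apply/implyP=> hA.
by rewrite ffunE (eqP (implyP (hz A) hA)) expp0.
Qed.

Definition cocycle_frob i (z : cocycle i) : cocycle i :=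
  Cocycle (cech_frob_cocycle z).

Lemma cocycle_frobB i : {morph @cocycle_frob i : z w / z - w}.
Proof. by move=> z w; apply/val_inj/cech_frobB. Qed.

Lemma coboundary_frob i (z : cocycle i) :
  coboundary z -> coboundary (cocycle_frob z).
Proof.
move=> /asboolP[b /forallP hb zb]; apply/asboolP; exists (cech_frob b).
  apply/forallP=> A; apply/implyP=> hA.
  by rewrite ffunE (eqP (implyP (hb A) hA)) expp0.
by rewrite cech_frob_d -zb.
Qed.

Definition coh_frob i (h : local_cohomology i) : local_cohomology i :=
  coh_class (cocycle_frob (repr h)).

Lemma coh_frobE i (z : cocycle i) :
  coh_frob (coh_class z) = coh_class (cocycle_frob z).
Proof.
apply/eqP; rewrite -subr_eq0 -raddfB /= -cocycle_frobB; apply/eqP.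
apply/coh_class0P/coboundary_frob/coh_class0P.
by rewrite raddfB /= -coh_classE subrr.
Qed.

Lemma coh_frobB i : {morph @coh_frob i : h h' / h - h'}.
Proof.
move=> h h'; rewrite (coh_classE h) (coh_classE h') -raddfB /=.
by rewrite !coh_frobE cocycle_frobB raddfB.
Qed.

HB.instance Definition _ i := GRing.isZmodMorphism.Build
  (local_cohomology i) (local_cohomology i) (@coh_frob i) (@coh_frobB i).

End Frobenius.

(* A grading of R in which every x_j has degree 1; [deg s a] says that a is   *)
(* homogeneous of degree s (or zero).                                         *)
Section Grading.
Variable deg : int -> R -> Prop.

Definition loc_deg (s : int) A (u : loc (xprod A)) : Prop :=
  exists a N, deg (s + (N * #|A|)%:Z) a /\ u = frac (xprod A) a N.

Definition coh_deg i (s : int) (h : local_cohomology i) : Prop :=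
  exists2 z : cocycle i, forall A, loc_deg s (cocycle_val z A) & h = coh_class z.

Definition coh_lt i (t : int) : {pred local_cohomology i} :=
  fun h => `[< exists (r : nat) (v : 'I_r -> local_cohomology i) (s : 'I_r -> int),
    (forall l, s l < t /\ coh_deg (s l) (v l)) /\ h = \sum_l v l >].

Section GradedFrobenius.
Variables (p : nat) (p_prime : prime p) (p0 : p%:R = 0 :> R).
Hypothesis degX : forall s a, deg s a -> deg (p%:Z * s) (a ^+ p).

Lemma coh_frob_deg i s (h : local_cohomology i) :
  coh_deg s h -> coh_deg (p%:Z * s) (coh_frob p_prime p0 h).
Proof.
move=> [z hz ->]; exists (cocycle_frob p_prime p0 z); last exact: coh_frobE.
move=> A; have [a [N [da zA]]] := hz A; exists (a ^+ p), (N * p)%N.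
rewrite /= ffunE zA fracX; split=> //.
have -> : p%:Z * s + (N * p * #|A|)%N%:Z = p%:Z * (s + (N * #|A|)%N%:Z) by lia.
exact: degX.
Qed.

Lemma coh_frob_lt_subproof i t (h : {h : local_cohomology i | h \in coh_lt t}) :
  coh_frob p_prime p0 (val h) \in coh_lt (p%:Z * t).
Proof.
case: h => h /= /asboolP[r [v [s [hv ->]]]]; apply/asboolP.
exists r, (fun l => coh_frob p_prime p0 (v l)), (fun l => p%:Z * s l).
split=> [l|]; last by rewrite raddf_sum.
have [lt_s ds] := hv l; split; last exact: coh_frob_deg.
by rewrite ltr_pM2l // ltz_nat prime_gt0.
Qed.

Definition coh_frob_lt i t (h : {h : local_cohomology i | h \in coh_lt t}) :
    {h : local_cohomology i | h \in coh_lt (p%:Z * t)} :=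
  exist _ (coh_frob p_prime p0 (val h)) (coh_frob_lt_subproof h).

End GradedFrobenius.
End Grading.
End Cech.

Section PolynomialRing.
Variables (k : fieldType) (n : nat).
Local Notation S := {mpoly k[n.+1]}.

(* [k : k^p] is finite: finitely many elements span k over k^p *)
Definition finite_over_pth_powers (p : nat) : Prop :=
  exists (r : nat) (b : 'I_r -> k),
    forall a, exists c : 'I_r -> k, a = \sum_l c l ^+ p * b l.

Definition irrelevant_ideal : S -> Prop :=
  ideal_gen (fun h => exists i : 'I_n.+1, h = 'X_i).

Definition mpoly_deg (s : int) (g : S) : Prop :=
  g = 0 \/ exists2 d : nat, s = d%:Z & g \is d.-homog.

Section Quotient.
Variable J : idealr S.
Local Notation R := {ideal_quot J}.

Definition quot_deg (s : int) (a : R) : Prop :=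
  exists2 g : S, mpoly_deg s g & a = \pi_R g.

Definition quot_var (i : 'I_n.+1) : R := \pi_R 'X_i.

Variables (p : nat) (charp : p \in [pchar k]).

Lemma quot_natr0 : p%:R = 0 :> R.
Proof.
rewrite -(rmorph_nat (\pi_R : {rmorphism S -> R})) -mpolyC_nat.
by rewrite (pcharf0 charp) mpolyC0 rmorph0.
Qed.

Lemma quot_degX (s : int) (a : R) :
  quot_deg s a -> quot_deg (p%:Z * s) (a ^+ p).
Proof.
have p_gt0 := prime_gt0 (pcharf_prime charp).
move=> [g dg ->]; exists (g ^+ p); last by rewrite rmorphXn.
case: dg => [->|[d -> dg]]; first by left; rewrite expr0n gtn_eqF.
by right; exists (d * p)%N; [rewrite mulnC PoszM | exact: dhomogMn].
Qed.

Definition quot_cohomology i := local_cohomology quot_var i.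

Definition quot_cohomology_lt i (t : int) : {pred quot_cohomology i} :=
  coh_lt quot_deg t.

Definition quot_frob_lt i (t : int) :
    {h : quot_cohomology i | h \in @quot_cohomology_lt i t} ->
    {h : quot_cohomology i | h \in @quot_cohomology_lt i (p%:Z * t)} :=
  coh_frob_lt (pcharf_prime charp) quot_natr0 quot_degX (t := t).

End Quotient.
End PolynomialRing.

Arguments quot_cohomology_lt {k n} J i t.
Arguments quot_frob_lt {k n} J {p} charp i t.

(* Main.v *)
Require Import Defs.
From HB Require Import structures.
From mathcomp Require Import all_boot all_order all_algebra.
From mathcomp Require Import ring_quotient mpoly boolp zify.

Import Defs.
Import Order.TTheory GRing.Theory Num.Theory.

Set Implicit Arguments.
Unset Strict Implicit.
Unset Printing Implicit Defensive.

Local Open Scope ring_scope.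

(** Notation: m = n + 1 is the number of variables, e = m - c, d is the sum of
    the degrees of the forms f_j and u is the (p-1)-st power of their product.
    C is the Cech complex of S on the variables, H^m(C) its top cohomology,
    spanned by the inverse monomials with all exponents negative, and R = S/J.

    The kernel of Frobenius is the annihilator of tau.  The f_j form a regular
    sequence and the cohomology of C/(f_1, ..., f_j)C vanishes in degrees below
    m - j ([cech_acyclic]), so the connecting homomorphisms identify H^e of
    C/JC with the elements of H^m(C) killed by J, with a shift of degrees by d.
    If z lifts a cocycle and dz = f w, then d(z^p) = f (f^(p-1) w^p); hence the
    Frobenius action F on H^e becomes u F on H^m(C) ([link_up], [link_down]).
    A class a / (x_0 ... x_n)^N of H^m(C) is zero exactly when a lies in
    q_N = (x_0^N, ..., x_n^N) ([top_boundaryP]), so the classes in question are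
    those with f_j a in q_N and u a^p in q_(Np).  Expand u = sum_l u_l^p b_l on
    a basis (b_l) of S over S^p.  The Cartier operators, which send u to u_l,
    are p^-1-linear and map q_(Np) into q_N, so u a^p in q_(Np) means that all
    u_l a are in q_N.  The same operators show that tau is generated by the f_j
    and the u_l, all of degree at most d ([tau_generators]).

    Suppose that tau is primary to the irrelevant ideal, and let z be a class
    of degrees < - e d killed by F.  It is killed by the generators g_l of tau.
    Choosing primitives of the g_l z, then of the Koszul cocycles that these
    form, and so on, one goes down from Cech degree e to Cech degree 0; each of
    the e steps raises the internal degree by at most d, so the last cochain is
    an element of R of negative degree and vanishes.  One can climb back,
    because the g_l generate the unit ideal wherever a variable is inverted and
    the Koszul complex is exact there: z is a boundary ([zigzag_killed]).

    Suppose conversely that a power x_i^r of large exponent is not in tau.  A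
    linear form on S_r that vanishes on tau but not at x_i^r is, by Macaulay
    duality, a nonzero element of H^m(C) of degree - r - m killed by tau
    ([inverse_system_nonzero]).  It comes from a nonzero class of H^e killed by
    F, of degree d - r - m < - e d.

    Rather than the rings S/(f_1, ..., f_j), the argument uses congruences
    modulo submodules of C; the cochains of R enter only at the end. *)

(** * Regular elements and the connecting homomorphism *)

Section Submodules.
Variables (S : comNzRingType) (C : lmodType S).

Definition submodule (M : C -> Prop) : Prop :=
  [/\ M 0, forall x y, M x -> M y -> M (x + y) & forall g x, M x -> M (g *: x)].

Definition add_multiples (M : C -> Prop) (g : S) (x : C) : Prop :=
  exists y, M (x - g *: y).

Definition regular_mod (M : C -> Prop) (g : S) : Prop :=
  forall x, M (g *: x) -> M x.

Lemma submodule0 M : submodule M -> M 0. Proof. by case. Qed.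
Lemma submoduleD M x y : submodule M -> M x -> M y -> M (x + y).
Proof. by case=> _ h _; exact: h. Qed.
Lemma submoduleZ M g x : submodule M -> M x -> M (g *: x).
Proof. by case=> _ _; apply. Qed.
Lemma submoduleN M x : submodule M -> M x -> M (- x).
Proof. by move=> hM; rewrite -scaleN1r; exact: submoduleZ. Qed.
Lemma submoduleB M x y : submodule M -> M x -> M y -> M (x - y).
Proof. by move=> hM hx hy; apply: submoduleD => //; exact: submoduleN. Qed.
Lemma submodule_sum M (I : Type) (r : seq I) (F : I -> C) :
  submodule M -> (forall i, M (F i)) -> M (\sum_(i <- r) F i).
Proof.
move=> hM h; elim/big_rec: _ => [|i x _ hx]; first exact: submodule0.
exact: submoduleD.
Qed.

Lemma add_multiples_submodule M g : submodule M -> submodule (add_multiples M g).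
Proof.
move=> hM; split.
- by exists 0; rewrite scaler0 subr0; exact: submodule0.
- move=> x y [x' hx] [y' hy]; exists (x' + y').
  by rewrite scalerDr opprD addrACA; exact: submoduleD.
move=> h x [x' hx]; exists (h *: x').
by rewrite scalerA mulrC -scalerA -scalerBr; exact: submoduleZ.
Qed.

Lemma add_multiplesW M g x : submodule M -> M x -> add_multiples M g x.
Proof. by move=> hM hx; exists 0; rewrite scaler0 subr0. Qed.

(** The submodule (f 0, ..., f (j - 1)) C; the recursion makes the passage from
    j to j + 1 a division by the single element f j. *)
Fixpoint seq_mod (f : nat -> S) (j : nat) : C -> Prop :=
  if j is j'.+1 then add_multiples (seq_mod f j') (f j') else fun x => x = 0.

Lemma seq_mod_submodule f j : submodule (seq_mod f j).
Proof.
elim: j => [|j ih]; last exact: add_multiples_submodule.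
by split=> [//|x y -> ->|g x ->]; rewrite ?addr0 ?scaler0.
Qed.

Lemma seq_mod_le f i j x : (i <= j)%N -> seq_mod f i x -> seq_mod f j x.
Proof.
elim: j => [|j ih]; first by rewrite leqn0 => /eqP->.
rewrite leq_eqVlt => /predU1P[->//|]; rewrite ltnS => hij hx.
by apply: add_multiplesW; [exact: seq_mod_submodule | exact: ih].
Qed.

Lemma seq_mod_gen f i j x : (i < j)%N -> seq_mod f j (f i *: x).
Proof.
move=> hij; apply: (@seq_mod_le f i.+1) => //.
by exists x; rewrite subrr; exact: (submodule0 (seq_mod_submodule f i)).
Qed.

Lemma seq_mod_linear f j (h : {linear C -> C}) (x : C) : seq_mod f j x -> seq_mod f j (h x).
Proof.
elim: j x => [|j ih] x /=; first by move=> ->; rewrite raddf0.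
by move=> [y /ih]; rewrite (raddfB h) /= (linearZZ h) => hy; exists (h y).
Qed.

End Submodules.

Section Complex.
Variables (S : comNzRingType) (C : lmodType S) (d : {linear C -> C}).
Hypothesis dd : forall c, d (d c) = 0.
Implicit Types (M : C -> Prop) (P : C -> C) (g h : S) (x y z v w : C).

Definition bdry_mod M x : Prop := exists y, M (x - d y).

(** With P the projection to one degree of C, this is the vanishing of the
    cohomology of C / M in that degree. *)
Definition acyclic_mod M P : Prop := forall z, M (d z) -> bdry_mod M (P z).

Lemma bdry_modW M x : submodule M -> M x -> bdry_mod M x.
Proof. by move=> hM hx; exists 0; rewrite linear0 subr0. Qed.

Section OneElement.
Variables (M : C -> Prop) (g : S).
Hypotheses (hM : submodule M) (dM : forall x, M x -> M (d x)) (g_reg : regular_mod M g).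

Lemma connecting_inj x v : M (d x - g *: v) ->
  bdry_mod (add_multiples M g) x -> bdry_mod M v.
Proof.
move=> hxv [y [y' hy]]; exists y'; apply: g_reg.
rewrite scalerBr.
have -> : g *: v - g *: d y' = d (x - d y - g *: y') - (d x - g *: v).
  by rewrite !(raddfB d) /= dd subr0 (linearZZ d) /= opprB [RHS]addrC addrA subrK.
by apply: submoduleB => //; exact: dM.
Qed.

Lemma connecting_surj (P : {linear C -> C}) x v : P x = x -> (forall x, M x -> M (P x)) ->
  acyclic_mod M P -> M (d x - g *: v) -> bdry_mod M v -> bdry_mod (add_multiples M g) x.
Proof.
move=> Px PM acy hxv [y hy].
have /acy[y' hy'] : M (d (x - g *: y)).
  rewrite (raddfB d) /= (linearZZ d) /=.
  have -> : d x - g *: d y = (d x - g *: v) + g *: (v - d y).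
    by rewrite scalerBr addrA subrK.
  by apply: submoduleD => //; exact: submoduleZ.
exists y', (P y).
by move: hy'; rewrite (raddfB P) /= (linearZZ P) /= Px addrAC.
Qed.

(** When x is a cocycle modulo M + g C, the class of v is the image of that of x
    under the connecting homomorphism of
    0 -> C / M -> C / M -> C / (M + g C) -> 0, the first map being g.  This
    homomorphism is injective where the cohomology of C / M vanishes. *)
Lemma connecting (P : {linear C -> C}) x v : P x = x -> (forall x, M x -> M (P x)) ->
  acyclic_mod M P -> M (d x - g *: v) ->
  bdry_mod (add_multiples M g) x <-> bdry_mod M v.
Proof.
by move=> Px PM acy hxv; split; [apply: connecting_inj | apply: (connecting_surj Px)].
Qed.

(** In the same long exact sequence the cohomology of C / (M + g C) in the degree
    of P lies between those of C / M in the degrees of P and of P1. *)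
Lemma acyclic_add_multiples (P P1 : {linear C -> C}) :
  (forall x, P (P x) = P x) -> (forall x, M x -> M (P x)) -> (forall x, M x -> M (P1 x)) ->
  (forall x, P1 (d x) = d (P x)) ->
  acyclic_mod M P -> acyclic_mod M P1 -> acyclic_mod (add_multiples M g) P.
Proof.
move=> PP PM P1M Pd acy acy1 z [w hw].
apply: (@connecting_surj P _ (P1 w)) => //.
  by rewrite -Pd -(linearZZ P1) -(raddfB P1); exact: P1M.
apply: acy1; apply: g_reg.
have -> : g *: d w = - d (d z - g *: w) by rewrite (raddfB d) /= (linearZZ d) /= dd sub0r opprK.
by apply: submoduleN => //; exact: dM.
Qed.

(** Since the cohomology of C / (M + g C) vanishes one degree below, g acts
    injectively on the cohomology of C / M, where it is also locally nilpotent. *)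
Lemma acyclic_of_killed (P0 P P1 : {linear C -> C}) :
  (forall x, P0 (P0 x) = P0 x) -> (forall x, P (P x) = P x) ->
  (forall x, M x -> M (P x)) -> (forall x, M x -> M (P1 x)) ->
  (forall x, P (d x) = d (P0 x)) -> (forall x, P1 (d x) = d (P x)) ->
  acyclic_mod (add_multiples M g) P0 ->
  (forall z, M (d z) -> exists N, bdry_mod M (g ^+ N *: z)) -> acyclic_mod M P.
Proof.
move=> P0P0 PP PM P1M Pd0 Pd acy0 kill z dz.
have [|N] := kill (P z); first by rewrite -Pd; exact: P1M.
elim: N => [|N ih]; first by rewrite expr0 scale1r.
rewrite exprS -scalerA => -[y hy]; apply: ih.
have {hy}hy := PM _ hy; rewrite (raddfB P) /= Pd0 !(linearZZ P) /= PP in hy.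
apply: (@connecting_inj (P0 y)).
  by rewrite -opprB; exact: submoduleN.
rewrite -[P0 y]P0P0; apply: acy0; exists (g ^+ N *: P z).
by rewrite -opprB; exact: submoduleN.
Qed.

End OneElement.

(** * A zigzag between a complex and a Koszul complex *)

Section Koszul.
Variables (r : nat) (g : 'I_r -> S) (al : 'I_r -> {linear C -> C}).
Implicit Types (s : seq 'I_r).

(** The Koszul differential on cochains indexed by all finite sequences of
    generators, alternating or not: its square is still zero and the usual
    homotopy still contracts it. *)
Fixpoint koszul (y : seq 'I_r -> C) (s : seq 'I_r) : C :=
  if s is l :: s' then g l *: y s' - koszul (fun s2 => y (l :: s2)) s' else 0.

Lemma koszul_sub M s (y : seq 'I_r -> C) : submodule M ->
  (forall s', (size s').+1 = size s -> M (y s')) -> M (koszul y s).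
Proof.
move=> hM; elim: s y => [|l s ih] y hy /=; first exact: submodule0.
apply: submoduleB => //; first by apply: submoduleZ => //; apply: hy.
by apply: ih => s' hs'; apply: hy; rewrite /= hs'.
Qed.

Lemma koszulB s (y1 y2 : seq 'I_r -> C) :
  koszul (fun s => y1 s - y2 s) s = koszul y1 s - koszul y2 s.
Proof.
elim: s y1 y2 => [|l s ih] y1 y2 /=; first by rewrite subr0.
by rewrite ih scalerBr !opprB addrACA [RHS]addrACA; congr (_ + _); exact: addrC.
Qed.

Lemma koszul_lin (h : {linear C -> C}) s (y : seq 'I_r -> C) :
  koszul (fun s => h (y s)) s = h (koszul y s).
Proof.
elim: s y => [|l s ih] y /=; first by rewrite linear0.
by rewrite ih linearB linearZ.
Qed.

Lemma koszulZ a s (y : seq 'I_r -> C) :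
  koszul (fun s => a *: y s) s = a *: koszul y s.
Proof.
elim: s y => [|l s ih] y /=; first by rewrite scaler0.
by rewrite ih scalerBr !scalerA mulrC.
Qed.

Lemma koszul_koszul s (y : seq 'I_r -> C) : koszul (koszul y) s = 0.
Proof.
elim: s y => [//|l s ih] y /=.
by rewrite koszulB koszulZ ih subr0 subrr.
Qed.

Lemma koszul_sum s (y : 'I_r -> seq 'I_r -> C) :
  koszul (fun s => \sum_a y a s) s = \sum_a koszul (y a) s.
Proof.
elim: s y => [|l s ih] y /=; first by rewrite big1.
by rewrite (ih (fun a s2 => y a (l :: s2))) scaler_sumr -sumrB.
Qed.

Definition koszul_homotopy (y : seq 'I_r -> C) s : C := \sum_l al l (y (l :: s)).

Lemma koszul_homotopyP s (y : seq 'I_r -> C) :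
  koszul (koszul_homotopy y) s + koszul_homotopy (koszul y) s =
  \sum_l al l (g l *: y s).
Proof.
rewrite /koszul_homotopy koszul_sum -big_split; apply: eq_bigr => a _ /=.
by rewrite (koszul_lin (al a)) (raddfB (al a)) addrC subrK.
Qed.

(** H i j is meant to hold for the cochains of degree i whose internal degrees
    are those reached after j multiplications by generators.  The operators al
    express that the generators have a combination equal to 1 in positive
    degrees. *)
Section Zigzag.
Variables (M : C -> Prop) (e : nat) (H : nat -> nat -> C -> Prop).
Hypotheses (hM : submodule M) (dM : forall x, M x -> M (d x))
  (alM : forall l x, M x -> M (al l x)) (al_unit : forall x, \sum_l al l (g l *: d x) = d x)
  (HB : forall i j x y, H i j x -> H i j y -> H i j (x - y))
  (H_kos : forall i j l x, H i j x -> H i j.+1 (g l *: x))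
  (H_pos : forall i j x, H i.+1 j x -> \sum_l al l (g l *: x) = x)
  (H_bdry : forall i j x, H i.+1 j x -> bdry_mod M x -> exists2 y, H i j y & M (x - d y))
  (H_acyclic : forall i j x, (i < e)%N -> H i j x -> M (d x) -> bdry_mod M x)
  (H_end : forall x, H 0 e x -> x = 0).

Lemma koszul_H i j (y : seq 'I_r -> C) : (forall s, size s = j -> H i j (y s)) ->
  forall s, size s = j.+1 -> H i j.+1 (koszul y s).
Proof.
have gen s : forall n (y : seq 'I_r -> C), (forall s', size s' = n -> H i j (y s')) -> size s = n.+1 ->
    H i j.+1 (koszul y s).
  elim: s => [|l s ih] n y' hy //= [hs].
  case: n hy hs => [|n] hy hs.
    by move/size0nil: hs => ->; rewrite /= subr0; exact: (H_kos _ (hy [::] _)).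
  apply: HB; first exact: (H_kos _ (hy s _)).
  by apply: (ih n) => // s' hs'; apply: hy; rewrite /= hs'.
by move=> hy s; exact: gen.
Qed.

(** One step up: y - d v is a Koszul cocycle modulo M, and the Koszul complex is
    contractible in positive degrees. *)
Lemma zigzag_step j (y y1 v w : seq 'I_r -> C) :
  (forall s, size s = j -> \sum_l al l (g l *: y s) = y s) ->
  (forall s, size s = j.+1 -> M (koszul y s - d (y1 s))) ->
  (forall s, size s = j.+1 -> M (y1 s - koszul v s - d (w s))) ->
  exists v' : seq 'I_r -> C, forall s, size s = j -> M (y s - koszul v' s - d (v s)).
Proof.
move=> ypos hy hy1; pose x s := y s - d (v s).
exists (koszul_homotopy x) => s hs.
have kx s' : size s' = j.+1 -> M (koszul x s').
  move=> hs'; rewrite /x koszulB (koszul_lin d).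
  have -> : koszul y s' - d (koszul v s') =
     (koszul y s' - d (y1 s')) + d (y1 s' - koszul v s' - d (w s')).
    by rewrite !(raddfB d) /= dd subr0 addrA subrK.
  by apply: submoduleD => //; [exact: hy | apply/dM/hy1].
have xE : koszul (koszul_homotopy x) s + koszul_homotopy (koszul x) s = x s.
  rewrite koszul_homotopyP /x.
  under eq_bigr => l _ do rewrite scalerBr (raddfB (al l)).
  by rewrite sumrB (ypos s hs) al_unit.
have -> : y s - koszul (koszul_homotopy x) s - d (v s) = koszul_homotopy (koszul x) s.
  by rewrite addrAC -[y s - _]/(x s) -xE [X in X - _]addrC addrK.
by apply: submodule_sum => // l; apply/alM/kx; rewrite /= hs.
Qed.

(** By induction on i: the Koszul differential of y has a primitive y1 of degree
    i, to which the induction hypothesis applies; the descent ends at i = 0, where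
    the cochain vanishes for reasons of internal degree. *)
Lemma zigzag i j (y y' : seq 'I_r -> C) : (i + j.+1 = e)%N ->
  (forall s, size s = j.+1 -> H i j.+1 (y s)) ->
  (forall s, size s = j.+1 -> M (d (y s) - koszul y' s)) ->
  exists v w : seq 'I_r -> C, forall s, size s = j.+1 -> M (y s - koszul v s - d (w s)).
Proof.
elim: i j y y' => [|i ih] j y y' hij hy hy'.
  exists (fun=> 0), (fun=> 0) => s hs; rewrite (raddf0 d) subr0.
  rewrite (H_end (x := y s)); last by rewrite -hij; exact: hy.
  by rewrite sub0r; apply: submoduleN => //; apply: koszul_sub => // *; exact: submodule0.
have hk s : exists y1, size s = j.+2 -> H i j.+2 y1 /\ M (koszul y s - d y1).
  have [hs|hs] := eqVneq (size s) j.+2; last by exists 0 => hs'; rewrite hs' eqxx in hs.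
  have hH : H i.+1 j.+2 (koszul y s) by exact: koszul_H.
  have [|y1 h1 h2] := H_bdry hH; last by exists y1.
  apply: H_acyclic hH _; first by lia.
  rewrite -(koszul_lin d).
  have -> : koszul (fun s => d (y s)) s = koszul (fun s => d (y s) - koszul y' s) s.
    by rewrite koszulB koszul_koszul subr0.
  by apply: koszul_sub => // s' hs'; apply: hy'; lia.
have [y1 hy1] := choice hk.
have [|||v1 [w1 hvw]] := ih j.+1 y1 y; first by lia.
- by move=> s /hy1[].
- by move=> s /hy1[_ h]; rewrite -opprB; exact: submoduleN.
have [||v hv] := zigzag_step _ _ hvw (y := y) (j := j.+1).
- by move=> s hs; apply: (H_pos (hy s hs)).
- by move=> s /hy1[].
by exists v, v1.
Qed.

(** The zigzag starts at z placed on the empty sequence; the primitives of its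
    Koszul differential come from the hypothesis on the products g l z. *)
Lemma zigzag_killed z : (0 < e)%N -> H e 0 z -> M (d z) ->
  (forall l, bdry_mod M (g l *: z)) -> bdry_mod M z.
Proof.
move=> + hz dz gz; case ei: e => [//|i] _; rewrite ei in hz.
have hk s : exists y1, size s = 1%N -> H i 1 y1 /\ M (koszul (fun=> z) s - d y1).
  case: s => [|l [|? ?]]; try by exists 0.
  have [|y1 h1 h2] := @H_bdry i 1 (g l *: z) _ (gz l).
    exact: H_kos.
  by exists y1 => _; split; rewrite //= subr0.
have [y1 hy1] := choice hk.
have [|||v1 [w1 hvw]] := @zigzag i 0 y1 (fun=> z); first by lia.
- by move=> s /hy1[].
- by move=> s /hy1[_ h]; rewrite -opprB; exact: submoduleN.
have [||v hv] := zigzag_step _ _ hvw (y := fun=> z) (j := 0).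
- by move=> s _; exact: (@H_pos i 0).
- by move=> s /hy1[].
by exists (v1 [::]); have := hv [::] erefl; rewrite /= subr0.
Qed.
End Zigzag.
End Koszul.
End Complex.

(** * The Cech complex as a complex of modules *)

Section LocLemmas.
Variables (R : comNzRingType) (f : R).
Local Notation fr := (frac f).

Lemma fracD_same a b N : fr a N + fr b N = fr (a + b) N.
Proof.
by rewrite fracD -mulrDr frac_shift.
Qed.

Lemma frac0 N : fr 0 N = 0.
Proof. by apply/fracP; exists 0%N; rewrite !mulr0. Qed.

Lemma frac_sum (I : Type) (r : seq I) (F : I -> R) N :
  \sum_(i <- r) fr (F i) N = fr (\sum_(i <- r) F i) N.
Proof.
by elim/big_rec2: _ => [|i y1 y2 _ ->]; [rewrite frac0 | rewrite fracD_same].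
Qed.

Lemma frac1 : fr 1 0 = 1. Proof. by []. Qed.

Lemma fracMl g a N : fr g 0 * fr a N = fr (g * a) N.
Proof. by rewrite fracM add0n. Qed.

Lemma frac_max (a : R) N K : (N <= K)%N -> fr a N = fr (f ^+ (K - N)%N * a) K.
Proof. by move=> h; rewrite -(frac_shift f (K - N)%N) subnK. Qed.

Lemma frac_sign e a N : (-1) ^+ e * fr a N = fr ((-1) ^+ e * a) N.
Proof. by rewrite -frac1 fracN fracX mul0n fracM. Qed.

Definition loc_ideal (I : R -> Prop) (u : loc f) : Prop :=
  exists a N, I a /\ u = fr a N.

Variable I : R -> Prop.
Hypothesis idI : is_ideal I.

Lemma loc_idealE a N : loc_ideal I (fr a N) <-> exists L, I (f ^+ L * a).
Proof.
have [_ _ Im] := idI; split=> [[b [K [hb /fracP[L e]]]]|[L h]].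
  by exists (L + K)%N; rewrite e; exact: Im.
by exists (f ^+ L * a), (L + N)%N; rewrite frac_shift.
Qed.

Lemma loc_ideal0 : loc_ideal I 0.
Proof. by have [h _ _] := idI; exists 0, 0%N. Qed.

Lemma loc_idealM u v : loc_ideal I v -> loc_ideal I (u * v).
Proof.
have [_ _ Im] := idI; move=> [b [K [hb ->]]]; elim/fracW: u => a N.
by rewrite fracM; do 2!eexists; split; last by []; exact: Im.
Qed.

End LocLemmas.

Section CechModule.
Variables (R : comNzRingType) (m : nat) (x : 'I_m -> R).
Local Notation C := (cech x).
Implicit Types (A B : {set 'I_m}) (c : C).

Definition cech_scale (g : R) c : C := [ffun A : {set 'I_m} => frac _ g 0 * c A].

Fact cech_scaleA g h c : cech_scale g (cech_scale h c) = cech_scale (g * h) c.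
Proof. by apply/ffunP=> A; rewrite !ffunE mulrA fracM. Qed.
Fact cech_scale1 : left_id 1 cech_scale.
Proof. by move=> c; apply/ffunP=> A; rewrite !ffunE frac1 mul1r. Qed.
Fact cech_scaleDr : right_distributive cech_scale +%R.
Proof. by move=> g c e; apply/ffunP=> A; rewrite !ffunE mulrDr. Qed.
Fact cech_scaleDl c : {morph cech_scale^~ c : g h / g + h}.
Proof. by move=> g h; apply/ffunP=> A; rewrite !ffunE -mulrDl fracD_same. Qed.

HB.instance Definition _ := GRing.Zmodule_isLmodule.Build R (cech x)
  cech_scaleA cech_scale1 cech_scaleDr cech_scaleDl.

Lemma cech_scaleE g c A : (g *: c) A = frac _ g 0 * c A.
Proof. by rewrite [g *: c]/(cech_scale g c) ffunE. Qed.
Lemma cechDE c e A : (c + e) A = c A + e A. Proof. by rewrite ffunE. Qed.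
Lemma cechBE c e A : (c - e) A = c A - e A. Proof. by rewrite !ffunE. Qed.
Lemma cech0E A : (0 : C) A = 0. Proof. by rewrite ffunE. Qed.
Lemma cech_sumE (I : Type) (r : seq I) (F : I -> C) A :
  (\sum_(i <- r) F i) A = \sum_(i <- r) F i A.
Proof. by elim/big_rec2: _ => [|i y1 y2 _ <-]; rewrite ?cech0E ?cechDE. Qed.

Definition cech_sign A (j : 'I_m) : nat := #|[set l in A | (l < j)%N]|.

Lemma cech_dE c B : cech_d c B =
  \sum_(j in B) (-1) ^+ cech_sign B j * cech_res B (c (B :\ j)).
Proof. by rewrite ffunE. Qed.

Lemma cech_res0 A B : A \subset B -> cech_res B (0 : loc (xprod x A)) = 0.
Proof. by move=> sAB; rewrite -(frac0 _ 0) cech_resE // mul0r frac0. Qed.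

Lemma cech_d_scale : scalable (@cech_d R m x).
Proof.
move=> g c; apply/ffunP=> B; rewrite cech_scaleE !cech_dE mulr_sumr.
apply: eq_bigr => j jB; rewrite cech_scaleE cech_resM ?subD1set //.
by rewrite cech_resE ?subD1set // expr0 mulr1 mulrCA.
Qed.

HB.instance Definition _ := GRing.isScalable.Build R C C _ (@cech_d R m x) cech_d_scale.

Definition cech_part (i : nat) c : C := [ffun A : {set 'I_m} => if #|A| == i then c A else 0].

Fact cech_part_is_linear i : linear (cech_part i).
Proof.
move=> g c e; apply/ffunP=> A.
by rewrite cechDE cech_scaleE !ffunE; case: eqP; rewrite ?mulr0 ?addr0.
Qed.
HB.instance Definition _ i := GRing.isLinear.Build R C C _ (cech_part i) (cech_part_is_linear i).

Lemma cech_partE i c A : cech_part i c A = if #|A| == i then c A else 0.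
Proof. by rewrite ffunE. Qed.

Lemma cech_part_id i c : cech_part i (cech_part i c) = cech_part i c.
Proof. by apply/ffunP=> A; rewrite !cech_partE; case: eqP. Qed.

Lemma cech_part_d i c : cech_part i.+1 (cech_d c) = cech_d (cech_part i c).
Proof.
apply/ffunP=> B; rewrite cech_partE !cech_dE.
have h j : j \in B -> #|B| = #|B :\ j|.+1 by move=> jB; rewrite (cardsD1 j B) jB.
case: eqP => hB.
  apply: eq_bigr => j jB; rewrite cech_partE; have := h j jB; rewrite hB => -[<-].
  by rewrite eqxx.
rewrite big1 // => j jB; rewrite cech_partE; case: eqP => [e|_].
  by rewrite (h j jB) e in hB.
by rewrite cech_res0 ?subD1set // mulr0.
Qed.

Lemma cech_part0_d c : cech_part 0 (cech_d c) = 0.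
Proof.
apply/ffunP=> B; rewrite cech_partE cech_dE cech0E.
by case: eqP => // /eqP/[!cards_eq0]/eqP->; rewrite big_pred0 // => j; rewrite inE.
Qed.

(** The submodule I C: the components of C are localizations. *)
Definition cech_ideal (I : R -> Prop) c : Prop := forall A, loc_ideal I (c A).

Lemma cech_common_denominator c : exists N (a : {set 'I_m} -> R), forall A, c A = frac _ (a A) N.
Proof.
have hA A : exists aN : R * nat, c A = frac _ aN.1 aN.2.
  by exists (repr (c A)); exact: fracE.
have [aN haN] := choice hA; pose N := (\max_A (aN A).2)%N.
exists N, (fun A => xprod x A ^+ (N - (aN A).2)%N * (aN A).1) => A.
by rewrite haN; apply: frac_max; exact: leq_bigmax.
Qed.

Lemma xprodU1 A j : j \notin A -> xprod x (j |: A) = x j * xprod x A.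
Proof. by move=> jA; rewrite /xprod big_setU1. Qed.

Lemma xprodD1 B j : j \in B -> xprod x (B :\: (B :\ j)) = x j.
Proof.
move=> jB; rewrite (_ : B :\: (B :\ j) = [set j]) /xprod ?big_set1 //.
by apply/setP=> l; rewrite !inE negb_and negbK andb_orl andNb orbF andb_idr // => /eqP->.
Qed.

Lemma cech_d_supp c B j : j \notin B -> (forall A, j \in A -> c A = 0) ->
  cech_d c (j |: B) = (-1) ^+ cech_sign B j * cech_res (j |: B) (c B).
Proof.
move=> jB hc; rewrite cech_dE (bigD1 j) ?setU11 //= [X in _ + X]big1 ?addr0.
  rewrite setU1K //; congr ((-1) ^+ _ * _); apply: eq_card => l.
  by rewrite !inE; case: eqP => // ->; rewrite ltnn !andbF.
move=> l /andP[lB lj]; rewrite hc ?cech_res0 ?subD1set ?mulr0 //.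
by rewrite !inE eq_sym lj eqxx.
Qed.

(** The Cech complex is contractible where x j is inverted.  The homotopy takes
    the component at j |: A to the one at A; a factor x j ^+ N brings it into the
    localization at A, where it has the same numerator. *)
Lemma cech_cocycle_killed I (j : 'I_m) c : is_ideal I ->
  (forall a, I (x j * a) -> I a) -> cech_ideal I (cech_d c) ->
  exists N y, cech_ideal I (x j ^+ N *: c - cech_d y).
Proof.
move=> idI xreg dc; have [N [a ha]] := cech_common_denominator c.
have xregX L b : I (x j ^+ L * b) -> I b.
  by elim: L => [|L ih]; rewrite ?mul1r // exprS -mulrA => /xreg.
pose y : C := [ffun A : {set 'I_m} => if j \in A then 0 else
                 (-1) ^+ cech_sign A j * frac (xprod x A) (a (j |: A)) N].
have yE A : y A = if j \in A then 0 else
   (-1) ^+ cech_sign A j * frac (xprod x A) (a (j |: A)) N by rewrite ffunE.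
exists N, y; pose q := x j ^+ N *: c - cech_d y; rewrite -/q.
(* the homotopy identity on the sets that contain j *)
have q0 B : j \in B -> q B = 0.
  move=> jB; rewrite cechBE cech_scaleE ha fracMl.
  have sB : B :\ j \subset B by exact: subD1set.
  rewrite cech_dE (bigD1 j) //= [X in _ - (_ + X)]big1 => [|l /andP[lB lj]]; last first.
    by rewrite yE !inE eq_sym lj jB cech_res0 ?subD1set ?mulr0.
  rewrite yE !inE eqxx /= setD1K // frac_sign cech_resE // xprodD1 //.
  have -> : cech_sign (B :\ j) j = cech_sign B j.
    by apply: eq_card => l; rewrite !inE; case: eqP => // ->; rewrite ltnn !andbF.
  by rewrite -mulrA -frac_sign signrMK addr0 [a B * _]mulrC subrr.
have dq : cech_ideal I (cech_d q).
  rewrite raddfB /= cech_d2 subr0 cech_d_scale => A.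
  by rewrite cech_scaleE; exact: loc_idealM.
move=> B; have [jB|jB] := boolP (j \in B); first by rewrite q0 //; exact: loc_ideal0.
(* elsewhere q is in I C after inverting x j, which is regular modulo I *)
have := dq (j |: B); rewrite (cech_d_supp jB q0) => h.
have {h} : loc_ideal I (cech_res (j |: B) (q B)).
  have -> : cech_res (j |: B) (q B) = (-1) ^+ cech_sign B j *
     ((-1) ^+ cech_sign B j * cech_res (j |: B) (q B)).
    by rewrite signrMK.
  exact: loc_idealM.
elim/fracW: (q B) => b K; rewrite cech_resE ?subsetU1 // => /loc_idealE[] // L.
have -> : xprod x ((j |: B) :\: B) = x j.
  have -> : (j |: B) :\: B = [set j].
    by apply/setP=> l; rewrite !inE; case: eqP => [->|]; rewrite ?jB //= andNb.
  by rewrite /xprod big_set1.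
rewrite xprodU1 // exprMn -mulrA => /xregX h; apply/loc_idealE => //; exists L.
by apply: (xregX K); rewrite mulrCA [X in _ * X]mulrC.
Qed.

End CechModule.

(** Multiplication by sections of the localizations: it carries the relations
    with value 1 that the generators of tau satisfy once a variable is inverted. *)
Section CechMult.
Variables (R : comNzRingType) (m : nat) (x : 'I_m -> R).
Variable u : forall A : {set 'I_m}, loc (xprod x A).

Definition cech_mult (c : cech x) : cech x := [ffun A : {set 'I_m} => u A * c A].

Fact cech_mult_is_linear : linear cech_mult.
Proof.
move=> g c e; apply/ffunP=> A; by rewrite cechDE cech_scaleE !ffunE mulrDr mulrCA.
Qed.
HB.instance Definition _ :=
  GRing.isLinear.Build R (cech x) (cech x) _ cech_mult cech_mult_is_linear.

Lemma cech_multE c A : cech_mult c A = u A * c A. Proof. by rewrite ffunE. Qed.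
End CechMult.

(** * Coefficients of polynomials, powers of the variables, Cartier operators *)

Section Coefficients.
Variables (k : fieldType) (m : nat).
Local Notation S := {mpoly k[m]}.
Implicit Types (a g u v : S) (b c : 'X_{1..m}).

Lemma mcoeffMXE a c b :
  (a * 'X_[c])@_b = if (c <= b)%MM then a@_(b - c)%MM else 0.
Proof.
case: ifPn => [h|h]; first by rewrite -{1}(submK h) addmC mcoeffMX.
rewrite [a]mpolyE mulr_suml raddf_sum big1 // => e _ /=.
rewrite -scalerAl mcoeffZ -mpolyXD mcoeffX; case: eqP => [e1|]; last by rewrite mulr0.
by rewrite -e1 lem_addl in h.
Qed.

Lemma mcoeffM_supp g a b :
  (g * a)@_b = \sum_(c <- msupp a) a@_c * (if (c <= b)%MM then g@_(b - c)%MM else 0).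
Proof.
rewrite {1}[a]mpolyE mulr_sumr raddf_sum; apply: eq_bigr => c _ /=.
by rewrite -scalerAr mcoeffZ mcoeffMXE.
Qed.

Definition mpoly_of (K : nat) (h : 'X_{1..m} -> k) : S :=
  \sum_(b : 'X_{1..m < K}) h b *: 'X_[b].

Lemma mcoeff_mpoly_of K h b : (mpoly_of K h)@_b = if (mdeg b < K)%N then h b else 0.
Proof.
case: ltnP => hb; first exact: mcoeff_mpoly.
rewrite raddf_sum big1 // => c _ /=; rewrite mcoeffZ mcoeffX; case: eqP => [e|].
  by have := bmdeg c; rewrite e ltnNge hb.
by rewrite mulr0.
Qed.

Definition restrict_deg (D : pred nat) a : S :=
  mpoly_of (msize a) (fun b => if D (mdeg b) then a@_b else 0).

Lemma mcoeff_restrict_deg D a b : (restrict_deg D a)@_b = if D (mdeg b) then a@_b else 0.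
Proof.
rewrite mcoeff_mpoly_of; case: ltnP => // /msize_mdeg_ge/memN_msupp_eq0->.
by rewrite if_same.
Qed.

Lemma restrict_degB D a a' : restrict_deg D (a - a') = restrict_deg D a - restrict_deg D a'.
Proof.
apply/mpolyP=> b; rewrite mcoeffB !mcoeff_restrict_deg mcoeffB.
by case: ifP; rewrite ?subr0.
Qed.

Lemma restrict_deg0 D : restrict_deg D 0 = 0.
Proof. by apply/mpolyP=> b; rewrite mcoeff_restrict_deg mcoeff0 if_same. Qed.

Lemma restrict_degM D e g a : g \is e.-homog ->
  restrict_deg D (a * g) = restrict_deg (fun j => D (j + e)%N) a * g.
Proof.
move=> /dhomogP hg; apply/mpolyP=> b; rewrite mcoeff_restrict_deg !mcoeffM_supp.
case: ifPn => hD.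
  rewrite big_seq [RHS]big_seq; apply: eq_bigr => c /hg /= hc.
  by case: ifP => // hcb; rewrite mcoeff_restrict_deg -hc -mdegD submK // hD.
rewrite [RHS]big_seq big1 // => c /hg /= hc.
case: ifP; rewrite ?mulr0 // => hcb.
by rewrite mcoeff_restrict_deg -hc -mdegD submK // (negbTE hD) mulr0.
Qed.

Lemma restrict_deg_restrict (D E : pred nat) a :
  restrict_deg D (restrict_deg E a) = restrict_deg (predI D E) a.
Proof.
by apply/mpolyP=> b; rewrite !mcoeff_restrict_deg /=; case: (D _); case: (E _).
Qed.

Lemma restrict_deg_eq (D E : pred nat) a : D =1 E -> restrict_deg D a = restrict_deg E a.
Proof. by move=> h; apply/mpolyP=> b; rewrite !mcoeff_restrict_deg h. Qed.

(** The ideal (x_0 ^ N, ..., x_(m-1) ^ N), given by the monomials outside it. *)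
Definition var_power_ideal (N : nat) a : Prop :=
  forall b, (forall i, (b i < N)%N) -> a@_b = 0.

Lemma var_power_idealM N g a : var_power_ideal N a -> var_power_ideal N (g * a).
Proof.
move=> ha b hb; rewrite mulrC mcoeffM_supp big1 // => c _.
case: ifP; rewrite ?mulr0 // => hc; rewrite ha ?mulr0 // => i.
by rewrite mnmBE (leq_ltn_trans (leq_subr _ _)).
Qed.

Lemma var_power_idealD N a a' :
  var_power_ideal N a -> var_power_ideal N a' -> var_power_ideal N (a + a').
Proof. by move=> h h' b hb; rewrite mcoeffD h // h' // addr0. Qed.

Lemma var_power_ideal_sum N (T : Type) (r : seq T) F :
  (forall i, var_power_ideal N (F i)) -> var_power_ideal N (\sum_(i <- r) F i).
Proof.
move=> h; elim/big_rec: _ => [|i y _ hy]; first by move=> b _; rewrite mcoeff0.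
exact: var_power_idealD.
Qed.

Lemma var_power_ideal_split N a : var_power_ideal N a ->
  exists a_ : 'I_m -> S, a = \sum_j 'X_j ^+ N * a_ j.
Proof.
move=> ha; pose P g := exists a_ : 'I_m -> S, g = \sum_j 'X_j ^+ N * a_ j.
rewrite -/(P a) [a]mpolyE; rewrite big_seq; apply: big_ind.
- by exists (fun=> 0); rewrite big1 // => j _; rewrite mulr0.
- move=> _ _ [f ->] [g ->]; exists (fun j => f j + g j).
  by rewrite -big_split; apply: eq_bigr => j _; rewrite mulrDr.
move=> b hb; have [j hj] : exists j, (N <= b j)%N.
  apply: contrapT => h; move: hb; rewrite mcoeff_msupp ha ?eqxx // => i.
  by rewrite ltnNge; apply/negP => h'; apply: h; exists i.
exists (fun i => if i == j then a@_b *: 'X_[b - U_(j) *+ N] else 0).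
rewrite (bigD1 j) //= eqxx big1 ?addr0 => [|i /negbTE->]; last by rewrite mulr0.
rewrite -scalerAr mpolyXn -mpolyXD addmC submK //.
apply/mnm_lepP=> i; rewrite mulmnE mnm1E; case: eqP => [<-|]; by rewrite ?mul1n.
Qed.

Lemma dhomog_restrict e (D : pred nat) a : (forall j, D j -> j = e) ->
  restrict_deg D a \is e.-homog.
Proof.
move=> h; apply/dhomogP=> b; rewrite mcoeff_msupp mcoeff_restrict_deg.
by case: ifP => [/h //|_]; rewrite eqxx.
Qed.

Section Frobenius.
Variables (p : nat) (charp : p \in [pchar k]).
Let p_pr : prime p. Proof. exact: pcharf_prime charp. Qed.

Lemma mpoly_natr0 : p%:R = 0 :> S.
Proof. by rewrite -mpolyC_nat (pcharf0 charp) mpolyC0. Qed.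

Lemma mpoly_pow_sum a : a ^+ p = \sum_(c <- msupp a) (a@_c ^+ p) *: 'X_[c *+ p].
Proof.
rewrite {1}[a]mpolyE (big_morph _ (pFrobeniusD p_pr mpoly_natr0) (id1 := 0)); last first.
  by rewrite expr0n gtn_eqF ?prime_gt0.
by apply: eq_bigr => c _; rewrite exprZn mpolyXn.
Qed.

Lemma mcoeff_pow a b : (a ^+ p)@_b =
  if [forall i, p %| b i]%N then a@_[multinom (b i %/ p)%N | i < m] ^+ p else 0.
Proof.
have p0 := prime_gt0 p_pr.
rewrite mpoly_pow_sum raddf_sum /=; case: ifPn => [/forallP h|/forallPn[i hi]].
  set e := [multinom _ | _ < _].
  have -> : b = (e *+ p)%MM.
    by apply/mnmP=> i; rewrite mulmnE mnmE divnK.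
  transitivity (\sum_(c <- msupp a) (if c == e then a@_e ^+ p else 0)).
    apply: eq_bigr => c _; rewrite mcoeffZ mcoeffX.
    have -> : ((c *+ p)%MM == (e *+ p)%MM) = (c == e).
      apply/eqP/eqP=> [/mnmP h'|-> //]; apply/mnmP=> i.
      by have /eqP := h' i; rewrite !mulmnE eqn_pmul2r // => /eqP.
    by case: eqP => [->|]; rewrite ?mulr1 ?mulr0.
  have [he|he] := boolP (e \in msupp a).
    by rewrite (bigD1_seq e) ?msupp_uniq //= eqxx big1 ?addr0 // => c /negbTE->.
  rewrite (memN_msupp_eq0 he) expr0n gtn_eqF // big1 // => c _.
  by rewrite if_same.
rewrite big1 // => c _; rewrite mcoeffZ mcoeffX; case: eqP => [e|]; last by rewrite mulr0.
by rewrite -e mulmnE dvdn_mull in hi.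
Qed.

Lemma var_power_idealXp N a : var_power_ideal N a -> var_power_ideal (N * p) (a ^+ p).
Proof.
move=> ha b hb; rewrite mcoeff_pow; case: ifP => // _.
rewrite ha ?expr0n ?gtn_eqF ?prime_gt0 // => i.
by rewrite mnmE ltn_divLR ?prime_gt0.
Qed.

Section Cartier.
Variables (kap : k -> k) (al : 'X_{1..m}).
Hypotheses (kapD : {morph kap : c e / c + e}) (kapZ : forall z w : k, kap (z ^+ p * w) = z * kap w)
  (al_lt : forall i, (al i < p)%N).

(** When kap is a coordinate of k over k^p, cartier u is the coordinate of u on
    the corresponding element of a basis of S over S^p: the one with monomial
    'X_[al]. *)
Definition cartier u : S :=
  mpoly_of (msize u) (fun b => kap u@_(b *+ p + al)%MM).

Let kap0 : kap 0 = 0.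
Proof. by apply: (addrI (kap 0)); rewrite -kapD !addr0. Qed.

Lemma mcoeff_cartier u b : (cartier u)@_b = kap u@_(b *+ p + al)%MM.
Proof.
rewrite mcoeff_mpoly_of; case: ltnP => // h.
rewrite memN_msupp_eq0 ?kap0 //; apply: msize_mdeg_ge; rewrite mdegD mdegMn.
by apply: (leq_trans h); rewrite (leq_trans (leq_pmulr _ (prime_gt0 p_pr))) // leq_addr.
Qed.

Lemma cartierD u v : cartier (u + v) = cartier u + cartier v.
Proof. by apply/mpolyP=> b; rewrite mcoeffD !mcoeff_cartier mcoeffD kapD. Qed.

Lemma cartierM a u : cartier (u * a ^+ p) = cartier u * a.
Proof.
apply/mpolyP=> b; rewrite mcoeff_cartier [RHS]mcoeffM_supp mpoly_pow_sum mulr_sumr raddf_sum /=.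
rewrite (big_morph _ kapD kap0); apply: eq_bigr => c _.
rewrite -scalerAr mcoeffZ kapZ; congr (_ * _); rewrite mcoeffMXE mcoeff_cartier.
(* as al i < p *)
have -> : (c *+ p <= b *+ p + al)%MM = (c <= b)%MM.
  apply/mnm_lepP/mnm_lepP => h i; have := h i; rewrite mnmDE !mulmnE.
    move=> h'; rewrite -ltnS -(ltn_pmul2r (prime_gt0 p_pr)) mulSnr.
    by apply: leq_ltn_trans h' _; rewrite ltn_add2l.
  by move=> h'; rewrite (leq_trans (leq_mul h' (leqnn p))) // leq_addr.
case: ifP => // /mnm_lepP h; congr (kap _@__); apply/mnmP=> i.
rewrite !(mnmBE, mnmDE, mulmnE); have := h i; nia.
Qed.

Lemma cartier_var_power_ideal N u :
  var_power_ideal (N * p) u -> var_power_ideal N (cartier u).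
Proof.
move=> hu b hb; rewrite mcoeff_cartier hu ?kap0 // => i.
rewrite mnmDE mulmnE; have := hb i; have := al_lt i; nia.
Qed.

Lemma cartier_homog D u : u \is D.-homog -> cartier u \is ((D - mdeg al) %/ p)%N.-homog.
Proof.
move=> /dhomogP hu; apply/dhomogP=> b; rewrite mcoeff_msupp mcoeff_cartier => h.
have {}h : (b *+ p + al)%MM \in msupp u.
  by apply: contraNT h => /memN_msupp_eq0->; rewrite kap0.
by have := hu _ h; rewrite /= mdegD mdegMn => <-; rewrite addnK mulnK ?prime_gt0.
Qed.
End Cartier.
End Frobenius.
End Coefficients.

(** A spanning family of least cardinality is a basis, and Frobenius is injective,
    so each coordinate has a well-defined p-th root. *)
Lemma pth_power_coordinates (k : fieldType) (p : nat) (charp : p \in [pchar k]) :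
  finite_over_pth_powers k p ->
  exists (r : nat) (b : 'I_r -> k) (kap : 'I_r -> k -> k),
    [/\ forall l, {morph kap l : x y / x + y},
        forall l x y, kap l (x ^+ p * y) = x * kap l y
      & forall x, x = \sum_l kap l x ^+ p * b l].
Proof.
move=> kfin; have p0 : p%:R = 0 :> k := pcharf0 charp.
have FD := pFrobeniusD (pcharf_prime charp) p0.
have FB x y : (x - y) ^+ p = x ^+ p - y ^+ p :> k.
  by apply/eqP; rewrite eq_sym subr_eq -FD subrK.
pose spans r := `[< exists b : 'I_r -> k, forall a, exists c : 'I_r -> k,
                   a = \sum_l c l ^+ p * b l >].
have ex : exists r, spans r by case: kfin => r h; exists r; apply/asboolP.
case: (ex_minnP ex) => r /asboolP[b hb] rmin {ex kfin}.
have free c : \sum_l c l ^+ p * b l = 0 -> forall l, c l = 0.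
  move=> hc l; apply/eqP/negP => /negP cl0.
  case: r => [|r] in b hb rmin c hc l cl0 *; first by case: l {cl0}.
  suff /rmin : spans r by rewrite ltnn.
  apply/asboolP; exists (fun i => b (lift l i)) => a.
  have [e he] := hb a; exists (fun i => e (lift l i) - e l / c l * c (lift l i)).
  transitivity (a - (e l / c l) ^+ p * \sum_i c i ^+ p * b i).
    by rewrite hc mulr0 subr0.
  rewrite he mulr_sumr -sumrB (bigD1_ord l) //=.
  rewrite mulrA -exprMn divfK // subrr add0r; apply: eq_bigr => i _.
  by rewrite FB mulrBl [(e l / c l * _) ^+ p]exprMn -mulrA.
have [kap hkap] := choice hb.
have uniq_coord a c : a = \sum_l c l ^+ p * b l -> kap a =1 c.
  move=> hc l; apply/eqP; rewrite -subr_eq0; apply/eqP.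
  apply: (free (fun l => kap a l - c l)).
  under eq_bigr => i _ do rewrite FB mulrBl.
  by rewrite sumrB -hkap -hc subrr.
exists r, b, (fun l x => kap x l); split=> [l x y|l x y|x]; last exact: hkap.
  apply: (uniq_coord _ (fun l => kap x l + kap y l)).
  under eq_bigr => i _ do rewrite FD mulrDl.
  by rewrite big_split /= -!hkap.
apply: (uniq_coord _ (fun l => x * kap y l)).
under eq_bigr => i _ do rewrite exprMn -mulrA.
by rewrite -mulr_sumr -hkap.
Qed.

Section CartierDecomposition.
Variables (k : fieldType) (m : nat) (p : nat) (charp : p \in [pchar k]).
Variables (r : nat) (b : 'I_r -> k) (kap : 'I_r -> k -> k).
Hypotheses (kapD : forall l, {morph kap l : x y / x + y})
  (kapE : forall x, x = \sum_l kap l x ^+ p * b l).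
Local Notation S := {mpoly k[m]}.

Definition small_exponent (al : {ffun 'I_m -> 'I_p}) : 'X_{1..m} :=
  [multinom (al i : nat) | i < m].

Lemma small_exponent_lt al i : (small_exponent al i < p)%N.
Proof. by rewrite mnmE. Qed.

Lemma cartier_decomposition (u : S) :
  u = \sum_l \sum_al cartier p (kap l) (small_exponent al) u ^+ p
                       * (b l *: 'X_[small_exponent al]).
Proof.
have p_gt0 : (0 < p)%N by rewrite prime_gt0 ?(pcharf_prime charp).
apply/mpolyP=> e; rewrite raddf_sum [LHS]kapE; apply: eq_bigr => l _.
(* only the residues modulo p of the exponents of e contribute *)
pose al0 : {ffun 'I_m -> 'I_p} := [ffun i => Ordinal (ltn_pmod (e i) p_gt0)].
rewrite raddf_sum (bigD1 al0) //= big1 ?addr0 => [|al hal].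
  rewrite -scalerAr mcoeffZ mcoeffMXE ifT; last first.
    by apply/mnm_lepP=> i; rewrite mnmE ffunE leq_mod.
  rewrite (mcoeff_pow charp) ifT; last first.
    by apply/forallP=> i; rewrite mnmBE mnmE ffunE /= {1}(divn_eq (e i) p) addnK dvdn_mull.
  rewrite mulrC (mcoeff_cartier charp (small_exponent al0) (kapD l)); congr (b l * kap l u@__ ^+ p).
  apply/mnmP=> i; rewrite mnmDE mulmnE !(mnmE, mnmBE) ffunE /=.
  by rewrite {2}(divn_eq (e i) p) addnK mulnK // -divn_eq.
rewrite -scalerAr mcoeffZ mcoeffMXE; case: ifP => [/mnm_lepP hle|]; last by rewrite mulr0.
rewrite (mcoeff_pow charp); case: ifP => [/forallP hd|]; last by rewrite mulr0.
case/eqP: hal; apply/ffunP=> i; apply: val_inj; rewrite ffunE /=.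
have := hd i; have := hle i; rewrite mnmBE mnmE => h1 h2.
by rewrite -(subnK h1) -modnDml (eqP h2) add0n modn_small.
Qed.
End CartierDecomposition.

Section Functional.
Variables (k : fieldType) (T : finType) (W : (T -> k) -> Prop).
Hypotheses (W0 : W (fun=> 0)) (WD : forall v w, W v -> W w -> W (fun t => v t + w t))
  (WZ : forall a v, W v -> W (fun t => a * v t)).

(** A matrix of maximal rank with rows in W has row space W, and the columns of
    its cokernel are the linear forms that vanish on that space. *)
Lemma separating_functional v : ~ W v ->
  exists lam : T -> k, (forall w, W w -> \sum_t lam t * w t = 0) /\ \sum_t lam t * v t <> 0.
Proof.
move=> nWv; pose n := #|T|.
pose rowof (w : T -> k) : 'rV[k]_n := \row_i w (enum_val i).
pose fits r := `[< exists A : 'M[k]_n, (\rank A = r)%N /\ forall i, W (fun t => A i (enum_rank t)) >].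
have ex : exists r, fits r.
  exists 0%N; apply/asboolP; exists 0; rewrite mxrank0; split=> // i.
  by under eq_fun do rewrite mxE.
have bd r : fits r -> (r <= n)%N by move=> /asboolP[A [<- _]]; exact: rank_leq_row.
case: (ex_maxnP ex bd) => r /asboolP[A [rkA hA]] rmax {ex bd}.
have WA (w : 'rV[k]_n) : (w <= A)%MS -> W (fun t => w 0 (enum_rank t)).
  move=> /submxP[D ->].
  have -> : (fun t => (D *m A) 0 (enum_rank t)) = (fun t => \sum_i D 0 i * A i (enum_rank t)).
    by apply: funext => t; rewrite mxE.
  elim: (index_enum _) => [|i s ih].
    by under eq_fun do rewrite big_nil.
  under eq_fun do rewrite big_cons.
  by apply: WD => //; apply: WZ.
have AW w : W w -> (rowof w <= A)%MS.
  move=> hw; apply/negPn/negP => hn.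
  have hsub : (A <= A + rowof w)%MS by exact: addsmxSl.
  have hlt : (r < \rank (A + rowof w)%MS)%N.
    rewrite -rkA ltn_neqAle mxrankS // andbT.
    have [_ ->] := mxrank_leqif_sup hsub.
    by rewrite addsmx_sub submx_refl.
  suff /rmax : fits (\rank (A + rowof w)%MS) by rewrite leqNgt hlt.
  apply/asboolP; exists (A + rowof w)%MS; split=> // i.
  have /sub_addsmxP[[D E] /= hDE] : (row i (A + rowof w)%MS <= A + rowof w)%MS by exact: row_sub.
  have -> : (fun t => (A + rowof w)%MS i (enum_rank t)) =
     (fun t => (D *m A) 0 (enum_rank t) + E 0 0 * w t).
    apply: funext => t.
    have /rowP/(_ (enum_rank t)) := hDE; rewrite mxE => ->.
    by rewrite mxE; congr (_ + _); rewrite mxE big_ord1 mxE enum_rankK.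
  by apply: WD; [apply: WA; exact: submxMl | exact: WZ].
have hv : rowof v *m cokermx A != 0.
  rewrite -submxE; apply/negP => /WA; apply: contra_not nWv => h; congr W: h.
  by apply: funext => t; rewrite mxE enum_rankK.
have [j hj] : exists j, (rowof v *m cokermx A) 0 j != 0.
  apply: contrapT => h; case/eqP: hv; apply/rowP=> j; rewrite [RHS]mxE.
  by apply: contrapT => /eqP h'; apply: h; exists j.
have lamE w : \sum_t cokermx A (enum_rank t) j * w t = (rowof w *m cokermx A) 0 j.
  rewrite mxE (reindex (@enum_val T predT)) /=; last first.
    by exists enum_rank => i _; rewrite ?enum_valK ?enum_rankK.
  by apply: eq_bigr => i _; rewrite !mxE enum_valK mulrC.
exists (fun t => cokermx A (enum_rank t) j); split=> [w /AW|].
  by rewrite lamE submxE => /eqP->; rewrite mxE.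
by rewrite lamE; exact/eqP.
Qed.
End Functional.

(** * Grading and top cohomology of the polynomial Cech complex *)

Section IdealChain.
Variables (R : comNzRingType) (m : nat) (x : 'I_m -> R) (f : nat -> R).

Definition ideal_chain (j : nat) : R -> Prop := @seq_mod R R^o f j.

Lemma ideal_chain_is_ideal j : is_ideal (ideal_chain j).
Proof. by have [h0 hD hZ] := @seq_mod_submodule R R^o f j; split. Qed.

Lemma ideal_chainS j a : ideal_chain j.+1 a <-> exists b, ideal_chain j (a - f j * b).
Proof. by []. Qed.

Lemma ideal_chainP j a : ideal_chain j a <->
  ideal_gen (fun h => exists2 i : nat, (i < j)%N & h = f i) a.
Proof.
split.
  elim: j a => [|j ih] a.
    by move=> ->; exists 0%N, (fun=> 0), (fun=> 0); rewrite big_ord0; split=> // -[].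
  move=> [b /ih[r [c [e [he hE]]]]].
  exists r.+1, (fun i => oapp c b (unlift ord0 i)), (fun i => oapp e (f j) (unlift ord0 i)); split.
    move=> l; case: unliftP => [i _|_] /=; last by exists j.
    by have [i0 hi ->] := he i; exists i0; first exact: ltnW.
  rewrite big_ord_recl unlift_none /=; under eq_bigr => i _ do rewrite liftK /=.
  by rewrite -hE mulrC addrC; exact/esym/subrK.
move=> [r [c [e [he ->]]]].
have [h0 hD hZ] := ideal_chain_is_ideal j.
elim/big_rec: _ => // i y _ hy; apply: hD => //; apply: hZ.
have [i0 hi ->] := he i; rewrite -[f i0]mulr1; exact: (@seq_mod_gen R R^o f _ _ 1 hi).
Qed.

(** As localization is exact, membership in (f 0, ..., f (j - 1)) C is read on the
    numerators of the components. *)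
Lemma seq_mod_cechP j (c : cech x) : seq_mod f j c <-> cech_ideal (ideal_chain j) c.
Proof.
elim: j c => [|j ih] c /=.
  split=> [-> A|h]; first by rewrite cech0E; exact/loc_ideal0/(ideal_chain_is_ideal 0).
  by apply/ffunP=> A; have [a [N [-> ->]]] := h A; rewrite frac0 cech0E.
split.
  move=> [e /ih he] A; have [a [N [ha]]] := he A.
  rewrite cechBE cech_scaleE; elim/fracW: (e A) => b K; rewrite fracMl => /eqP.
  rewrite subr_eq => /eqP->; rewrite fracD; do 2!eexists; split; last by [].
  have [_ _ hZ] := ideal_chain_is_ideal j.
  apply/ideal_chainS; exists (xprod x A ^+ N * b).
  by rewrite mulrCA addrK; exact: hZ.
move=> h; have hA A : exists b : loc (xprod x A), loc_ideal (ideal_chain j) (c A - frac _ (f j) 0 * b).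
  have [a [N [/ideal_chainS[b hb] ->]]] := h A; exists (frac _ b N).
  by rewrite fracMl fracN fracD_same; exists (a - f j * b), N.
exists [ffun A => sval (cid (hA A))]; apply/ih => A.
by rewrite cechBE cech_scaleE ffunE; exact: svalP (cid (hA A)).
Qed.

Lemma seq_mod_cech_regular j g : (forall a, ideal_chain j (g * a) -> ideal_chain j a) ->
  @regular_mod R (cech x) (seq_mod f j) g.
Proof.
move=> reg c /seq_mod_cechP h; apply/seq_mod_cechP => A; have := h A.
have idI := ideal_chain_is_ideal j.
rewrite cech_scaleE; elim/fracW: (c A) => a N; rewrite fracMl.
move=> /loc_idealE[//|L hL]; apply/loc_idealE => //; exists L; apply: reg.
by rewrite mulrCA.
Qed.
End IdealChain.

Section PolynomialCech.
Variables (k : fieldType) (m : nat).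
Local Notation S := {mpoly k[m]}.
Local Notation X := (fun i : 'I_m => 'X_i : S).
Local Notation C := (cech X).
Implicit Types (A B : {set 'I_m}) (T : pred int).

Lemma xprodX A : xprod X A = 'X_[\sum_(j in A) U_(j)].
Proof. by rewrite /xprod mprodXE. Qed.

Lemma xprod_homog A N : xprod X A ^+ N \is (N * #|A|)%N.-homog.
Proof.
rewrite xprodX mpolyXn dhomogX /= mdegMn mdeg_sum mulnC.
by under eq_bigr do rewrite mdeg1; rewrite sum1_card.
Qed.

Lemma xprod_inj A N (a b : S) : xprod X A ^+ N * a = xprod X A ^+ N * b -> a = b.
Proof. by apply/mulfI; rewrite xprodX mpolyXn -msize_poly_eq0 msizeX. Qed.

(** The degree of a / x_A ^ N is that of a minus N * #|A|. *)
Definition loc_restrict T A (u : loc (xprod X A)) : loc (xprod X A) :=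
  frac _ (restrict_deg (fun j => T (j%:Z - ((repr u).2 * #|A|)%:Z)) (repr u).1) (repr u).2.

Lemma loc_restrictE T A a N : loc_restrict T (frac (xprod X A) a N) =
  frac _ (restrict_deg (fun j => T (j%:Z - (N * #|A|)%:Z)) a) N.
Proof.
rewrite /loc_restrict; have [L] := repr_frac (xprod X A) a N.
set u := repr _; case: u => b K /= e; apply/fracP; exists L.
rewrite ![_ ^+ _ * restrict_deg _ _]mulrC.
have := congr1 (restrict_deg (fun j => T (j%:Z - ((L + N + K) * #|A|)%:Z))) e.
rewrite ![_ ^+ _ * _]mulrC !(restrict_degM _ _ (xprod_homog _ _)) => h.
transitivity (restrict_deg (fun j => T ((j + (L + N) * #|A|)%:Z - ((L + N + K) * #|A|)%:Z)) b
   * xprod X A ^+ (L + N)).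
  by congr (_ * _); apply: restrict_deg_eq => j; congr T; move: #|A| => q; rewrite ?mulnDl; lia.
by rewrite h; congr (_ * _); apply: restrict_deg_eq => j; congr T; move: #|A| => q; rewrite ?mulnDl; lia.
Qed.

Lemma loc_restrictB T A (u v : loc (xprod X A)) :
  loc_restrict T (u - v) = loc_restrict T u - loc_restrict T v.
Proof.
elim/fracW: u => a N; elim/fracW: v => b K.
rewrite fracN fracD !loc_restrictE fracN fracD !mulrN restrict_degB.
rewrite ![_ ^+ _ * _]mulrC !(restrict_degM _ _ (xprod_homog _ _)).
by congr (frac _ (_ * _ - _ * _) _); apply: restrict_deg_eq => j; congr T;
  move: #|A| => q; rewrite ?mulnDl; lia.
Qed.

Lemma loc_restrict0 T A : loc_restrict T (0 : loc (xprod X A)) = 0.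
Proof. by rewrite -(frac0 _ 0) loc_restrictE restrict_deg0. Qed.

Lemma loc_restrict_res T A B (u : loc (xprod X A)) : A \subset B ->
  loc_restrict T (cech_res B u) = cech_res B (loc_restrict T u).
Proof.
move=> sAB; elim/fracW: u => a N.
rewrite cech_resE // !loc_restrictE cech_resE //; congr frac.
rewrite (restrict_degM _ _ (xprod_homog _ _)); congr (_ * _).
apply: restrict_deg_eq => j; congr T.
have : #|B| = (#|A| + #|B :\: A|)%N by rewrite -(cardsID A B) (setIidPr sAB).
by move=> ->; lia.
Qed.

Lemma loc_restrictZ T A (e : nat) (g : S) (u : loc (xprod X A)) : g \is e.-homog ->
  loc_restrict T (frac _ g 0 * u) = frac _ g 0 * loc_restrict (fun s => T (s + e%:Z)) u.
Proof.
move=> hg; elim/fracW: u => a N; rewrite fracMl !loc_restrictE fracMl; congr frac.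
rewrite ![g * _]mulrC (restrict_degM _ _ hg); congr (_ * _).
by apply: restrict_deg_eq => j; congr T; move: #|A| => q; rewrite ?mulnDl; lia.
Qed.

Definition cech_restrict T (c : C) : C := [ffun A : {set 'I_m} => loc_restrict T (c A)].

Lemma cech_restrictE T (c : C) A : cech_restrict T c A = loc_restrict T (c A).
Proof. by rewrite ffunE. Qed.

Lemma cech_restrictB T (c e : C) :
  cech_restrict T (c - e) = cech_restrict T c - cech_restrict T e.
Proof. by apply/ffunP=> A; rewrite !(cech_restrictE, cechBE) loc_restrictB. Qed.

HB.instance Definition _ T := GRing.isZmodMorphism.Build C C (cech_restrict T)
  (cech_restrictB T).

Lemma cech_restrict_d T (c : C) : cech_restrict T (cech_d c) = cech_d (cech_restrict T c).
Proof.
apply/ffunP=> B; rewrite cech_restrictE !cech_dE.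
have opp u : loc_restrict T (- u) = - @loc_restrict T B u.
  by rewrite -[- u]sub0r loc_restrictB loc_restrict0 sub0r.
have add : {morph @loc_restrict T B : u v / u + v}.
  by move=> u v; rewrite -{1}[v]opprK loc_restrictB opp opprK.
rewrite (big_morph _ add (loc_restrict0 T B)); apply: eq_bigr => j jB.
rewrite -signr_odd cech_restrictE -loc_restrict_res ?subD1set //.
by case: odd; rewrite ?expr0 ?mul1r // expr1 !mulN1r opp.
Qed.

Lemma cech_restrict_part T i (c : C) :
  cech_restrict T (cech_part i c) = cech_part i (cech_restrict T c).
Proof.
apply/ffunP=> B; rewrite !(cech_partE, cech_restrictE).
by case: eqP => // _; rewrite loc_restrict0.
Qed.

Lemma cech_restrictZ T (e : nat) (g : S) (c : C) : g \is e.-homog ->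
  cech_restrict T (g *: c) = g *: cech_restrict (fun s => T (s + e%:Z)) c.
Proof.
by move=> hg; apply/ffunP=> A; rewrite !(cech_restrictE, cech_scaleE) (loc_restrictZ _ _ hg).
Qed.

Lemma cech_restrict_restrict T T' (c : C) :
  cech_restrict T (cech_restrict T' c) = cech_restrict (predI T T') c.
Proof.
apply/ffunP=> A; rewrite !cech_restrictE; elim/fracW: (c A) => a N.
by rewrite !loc_restrictE restrict_deg_restrict; congr frac; apply: restrict_deg_eq.
Qed.

Lemma cech_restrict_eq T T' (c : C) : T =1 T' -> cech_restrict T c = cech_restrict T' c.
Proof.
move=> h; apply/ffunP=> A; rewrite !cech_restrictE; elim/fracW: (c A) => a N.
by rewrite !loc_restrictE; congr frac; apply: restrict_deg_eq => j; rewrite h.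
Qed.

Definition degrees_in T (c : C) : Prop := cech_restrict T c = c.

Lemma degrees_in_restrict T (c : C) : degrees_in T (cech_restrict T c).
Proof.
rewrite /degrees_in cech_restrict_restrict; apply: cech_restrict_eq => s /=.
by rewrite andbb.
Qed.

Lemma degrees_in_sub T T' (c : C) : (forall s, T s -> T' s) -> degrees_in T c -> degrees_in T' c.
Proof.
move=> h hc; rewrite /degrees_in -hc cech_restrict_restrict; apply: cech_restrict_eq => s /=.
by rewrite andb_idl //; exact: h.
Qed.

Lemma degrees_inB T (c e : C) : degrees_in T c -> degrees_in T e -> degrees_in T (c - e).
Proof. by rewrite /degrees_in cech_restrictB => -> ->. Qed.

Lemma degrees_inZ T (e : nat) (g : S) (c : C) : g \is e.-homog ->
  degrees_in (fun s => T (s + e%:Z)) c -> degrees_in T (g *: c).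
Proof. by move=> hg hc; rewrite /degrees_in (cech_restrictZ _ _ hg) hc. Qed.

Lemma seq_mod_restrict (f : nat -> S) (e : nat -> nat) j T (c : C) :
  (forall i, (i < j)%N -> f i \is (e i).-homog) ->
  seq_mod f j c -> seq_mod f j (cech_restrict T c).
Proof.
elim: j T c => [|j ih] T c hf /=; first by move=> ->; rewrite raddf0.
move=> [c' hc']; exists (cech_restrict (fun s => T (s + (e j)%:Z)) c').
rewrite -(cech_restrictZ _ _ (hf j (ltnSn j))) -cech_restrictB.
by apply: ih => // i hi; apply: hf; exact: ltnW.
Qed.

(** A boundary in top degree is a sum of fractions, each of them without some x_j
    in its denominator; so the top cohomology has the inverse monomials with all
    exponents negative as a basis. *)
Lemma top_boundaryP (w : C) a N : (forall A, A != setT -> w A = 0) ->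
  w setT = frac _ a N -> (exists y, w = cech_d y) <-> var_power_ideal N a.
Proof.
move=> w0 wT; split=> [[y wy]|].
  have [K [e he]] := cech_common_denominator y.
  move: wT; rewrite wy cech_dE.
  have -> : \sum_(j in setT) (-1) ^+ cech_sign setT j * cech_res setT (y (setT :\ j)) =
     frac _ (\sum_j 'X_j ^+ K * ((-1) ^+ cech_sign setT j * e (setT :\ j))) K.
    rewrite -frac_sum; apply: eq_big => [j|j jT]; first by rewrite inE.
    rewrite he cech_resE ?subD1set // xprodD1 // frac_sign.
    by congr frac; rewrite [RHS]mulrCA [e _ * _]mulrC.
  move/fracP => [L /esym]; rewrite !exprD -!mulrA => /xprod_inj ea b hb.
  (* 'X_[one] is the product of the variables *)
  pose one : 'X_{1..m} := (\sum_(j in [set: 'I_m]) U_(j))%MM.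
  have oneE i : one i = 1%N.
    rewrite /one mnm_sumE (bigD1 i) ?inE //= big1 => [|j /andP[_ /negbTE h]].
      by rewrite mnm1E eqxx.
    by rewrite mnm1E h.
  rewrite -(mcoeffMX a (one *+ K) b) mulrC -mpolyXn -xprodX ea mulr_sumr raddf_sum big1 // => j _.
  rewrite mulrA mulrC xprodX !mpolyXn -mpolyXD /= mcoeffMXE; case: ifP => // /mnm_lepP/(_ j).
  rewrite !mnmDE !mulmnE mnm1E eqxx oneE !mul1n addnC leq_add2l => h.
  by have := hb j; rewrite ltnNge h.
move=> /var_power_ideal_split[a_ aE].
exists [ffun A : {set 'I_m} => if #|A|.+1 == m then
   (if [pick j | j \notin A] is Some j then
      (-1) ^+ cech_sign setT j * frac _ (a_ j) N else 0) else 0].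
set y := [ffun _ => _]; apply/ffunP=> B; rewrite cech_dE.
have [->|BT] := eqVneq B setT; last first.
  rewrite w0 // big1 // => j jB; rewrite ffunE ifN ?cech_res0 ?subD1set ?mulr0 //.
  rewrite neq_ltn -ltnS; apply/orP; left.
  have := cardsD1 j B; rewrite jB add1n => <-; rewrite ltnS -[X in (_ <= X)%N]card_ord.
  by rewrite -cardsT; apply: proper_card; rewrite properEneq BT subsetT.
rewrite wT aE -frac_sum; apply: eq_big => [j|j _]; first by rewrite inE.
have cj : #|[set: 'I_m] :\ j|.+1 = m.
  by have := cardsD1 j [set: 'I_m]; rewrite inE add1n cardsT card_ord.
rewrite ffunE cj eqxx; case: pickP => [i|/(_ j)]; last by rewrite !inE eqxx.
rewrite !inE andbT negbK => /eqP->.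
rewrite [X in cech_res _ X]frac_sign cech_resE ?subD1set // xprodD1 ?inE //.
by rewrite -mulrA -frac_sign signrMK mulrC.
Qed.
End PolynomialCech.

(** * Vanishing below the top degree and iterated connecting homomorphisms *)

Section Vanishing.
Variables (k : fieldType) (m : nat).
Local Notation S := {mpoly k[m]}.
Local Notation X := (fun i : 'I_m => 'X_i : S).
Local Notation C := (cech X).
Local Notation d := (@cech_d S m X).
Local Notation part := (@cech_part S m X).

Definition var_seq (i : nat) : S := oapp (fun j : 'I_m => 'X_j) 0 (insub i).

Lemma var_chainP j a : (j <= m)%N -> ideal_chain var_seq j a <->
  forall b : 'X_{1..m}, (forall i : 'I_m, (i < j)%N -> b i = 0%N) -> a@_b = 0.
Proof.
elim: j a => [|j ih] a hj.
  split=> [-> b _|h]; first by rewrite mcoeff0.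
  by apply/mpolyP=> b; rewrite mcoeff0 h.
have xj : var_seq j = 'X_(Ordinal hj) by rewrite /var_seq insubT.
split.
  move=> /ideal_chainS[b0 /ih h] b hb.
  have := h (ltnW hj) b _; rewrite mcoeffB xj mulrC mcoeffMXE ifN ?subr0 => [->//|].
    by move=> i hi; apply: hb; exact: ltnW.
  by rewrite lep1mP hb //=.
move=> h; apply/ideal_chainS; rewrite xj.
exists (mpoly_of (msize a) (fun b => a@_(b + U_(Ordinal hj))%MM)).
apply/ih; first exact: ltnW.
move=> b hb; rewrite mcoeffB mulrC mcoeffMXE lep1mP.
have [b0|b0] := eqVneq (b (Ordinal hj)) 0%N; rewrite ?b0 /=.
  rewrite subr0; apply: h => i; rewrite ltnS leq_eqVlt => /predU1P[e|]; last exact: hb.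
  by rewrite -b0; congr (b _); exact: val_inj.
rewrite mcoeff_mpoly_of submK ?lep1mP //; case: ltnP; first by rewrite subrr.
move=> hm; rewrite subr0; apply/memN_msupp_eq0/msize_mdeg_ge.
by rewrite (leq_trans hm) // mdegB.
Qed.

Lemma var_chain_regular j a : (j < m)%N ->
  ideal_chain var_seq j (var_seq j * a) -> ideal_chain var_seq j a.
Proof.
move=> hj; have xj : var_seq j = 'X_(Ordinal hj) by rewrite /var_seq insubT.
move=> /(var_chainP _ (ltnW hj)) h; apply/(var_chainP _ (ltnW hj)) => b hb.
rewrite -(mcoeffMX a U_(Ordinal hj)) mulrC -xj; apply: h => i hi.
rewrite mnmDE hb // mnm1E addn0; case: eqP => // e.
by rewrite -e ltnn in hi.
Qed.

Lemma var_chain_kill j (z : C) : (j < m)%N -> seq_mod var_seq j (d z) ->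
  exists N, bdry_mod d (seq_mod var_seq j) (var_seq j ^+ N *: z).
Proof.
move=> hj; have xj : var_seq j = 'X_(Ordinal hj) by rewrite /var_seq insubT.
move=> /seq_mod_cechP h; have idI := ideal_chain_is_ideal var_seq j.
have [|N [y hy]] := @cech_cocycle_killed _ _ _ _ (Ordinal hj) _ idI _ h.
  by move=> a; rewrite -xj; exact: var_chain_regular.
by exists N, y; apply/seq_mod_cechP; rewrite xj.
Qed.

(** Multiplication by x_j is injective modulo (x_0, ..., x_(j-1)) and locally
    nilpotent on cohomology; this reduces degree i to degree i - 1 modulo one
    more variable, and nothing is left below degree 0. *)
Lemma cech_acyclic_var i j : (i + j < m)%N ->
  acyclic_mod d (seq_mod var_seq j) (part i).
Proof.
have cech_dd c : d (d c) = 0 by exact: cech_d2.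
elim: i j => [|i ih] j hij.
  have hj : (j < m)%N by [].
  apply: (@acyclic_of_killed S C d cech_dd (seq_mod var_seq j) (var_seq j) _ _ _
           \0 (part 0) (part 1)).
  - exact: seq_mod_submodule.
  - move=> c; exact: (seq_mod_linear d).
  - by apply: seq_mod_cech_regular => a; exact: var_chain_regular.
  - by [].
  - exact: cech_part_id.
  - move=> c; exact: (seq_mod_linear (part 0)).
  - move=> c; exact: (seq_mod_linear (part 1)).
  - by move=> c /=; rewrite cech_part0_d raddf0.
  - exact: cech_part_d.
  - move=> z _; apply: bdry_modW; first exact/add_multiples_submodule/seq_mod_submodule.
    by apply: submodule0; apply: add_multiples_submodule; exact: seq_mod_submodule.
  by move=> z; exact: var_chain_kill.
have hj : (j < m)%N by lia.
apply: (@acyclic_of_killed S C d cech_dd (seq_mod var_seq j) (var_seq j) _ _ _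
         (part i) (part i.+1) (part i.+2)).
- exact: seq_mod_submodule.
- move=> c; exact: (seq_mod_linear d).
- by apply: seq_mod_cech_regular => a; exact: var_chain_regular.
- exact: cech_part_id.
- exact: cech_part_id.
- move=> c; exact: (seq_mod_linear (part i.+1)).
- move=> c; exact: (seq_mod_linear (part i.+2)).
- exact: cech_part_d.
- exact: cech_part_d.
- by apply: (ih j.+1); lia.
by move=> z; exact: var_chain_kill.
Qed.
End Vanishing.

Section RegularChainVanishing.
Variables (k : fieldType) (m : nat).
Local Notation S := {mpoly k[m]}.
Local Notation X := (fun i : 'I_m => 'X_i : S).
Local Notation C := (cech X).
Local Notation d := (@cech_d S m X).
Local Notation part := (@cech_part S m X).
Variables (c : nat) (f : nat -> S).
Hypothesis f_reg : forall i a, (i < c)%N -> ideal_chain f i (f i * a) -> ideal_chain f i a.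
Local Notation M := (@seq_mod S C f).

Lemma cech_acyclic j i : (j <= c)%N -> (i + j < m)%N -> acyclic_mod d (M j) (part i).
Proof.
elim: j i => [|j ih] i hj hij; first exact: (@cech_acyclic_var k m i 0).
apply: (@acyclic_add_multiples S C d (@cech_d2 _ _ _) (M j) (f j) _ _ _ (part i) (part i.+1)).
- exact: seq_mod_submodule.
- move=> z; exact: (seq_mod_linear d).
- by apply: seq_mod_cech_regular => a; exact: f_reg.
- exact: cech_part_id.
- move=> z; exact: (seq_mod_linear (part i)).
- move=> z; exact: (seq_mod_linear (part i.+1)).
- exact: cech_part_d.
- by apply: ih; lia.
by apply: ih; lia.
Qed.

End RegularChainVanishing.

Section Links.
Variables (k : fieldType) (m : nat) (p : nat) (charp : p \in [pchar k]).
Local Notation S := {mpoly k[m]}.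
Local Notation X := (fun i : 'I_m => 'X_i : S).
Local Notation C := (cech X).
Local Notation d := (@cech_d S m X).
Local Notation part := (@cech_part S m X).
Local Notation phi := (@cech_frob S m X p).

Let p_pr : prime p. Proof. exact: pcharf_prime charp. Qed.
Let p0 : p%:R = 0 :> S. Proof. exact: mpoly_natr0. Qed.
Let phiB : {morph phi : c e / c - e}. Proof. exact: cech_frobB. Qed.

Lemma cech_frobZ g (c : C) : phi (g *: c) = g ^+ p *: phi c.
Proof. by apply/ffunP=> A; rewrite !(ffunE, cech_scaleE) exprMn fracX mul0n. Qed.

Lemma cech_frob_part i (c : C) : phi (part i c) = part i (phi c).
Proof.
apply/ffunP=> A; rewrite cech_partE !ffunE; case: eqP => // _.
by rewrite expr0n gtn_eqF ?prime_gt0.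
Qed.

Variables (c : nat) (f : nat -> S) (e : nat -> nat).
Hypotheses (f_homog : forall i, (i < c)%N -> f i \is (e i).-homog)
  (f_reg : forall i a, (i < c)%N -> ideal_chain f i (f i * a) -> ideal_chain f i a).
Local Notation M := (@seq_mod S C f).

Lemma seq_mod_frob j (z : C) : M j z -> M j (phi z).
Proof.
elim: j z => [|j ih] z /=; first by move=> ->; rewrite (cech_frob0 _ p_pr).
move=> [y /ih]; rewrite phiB cech_frobZ => hy; exists (f j ^+ p.-1 *: phi y).
by rewrite scalerA -exprS prednK ?prime_gt0.
Qed.

Definition frob_mult j : S := \prod_(i < j) f i ^+ p.-1.

(** What remains of the iterated connecting homomorphism from H^(m-j)(C / M j)
    to H^m(C), when it sends the class of z to that of w: it is injective,
    S-linear, and turns Frobenius into Frobenius times [frob_mult j]. *)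
Definition linked j (z w : C) : Prop :=
  forall h : S,
    (bdry_mod d (M j) (h *: z) <-> bdry_mod d (M 0) (h *: w)) /\
    (bdry_mod d (M j) (h *: phi z) <-> bdry_mod d (M 0) (h *: (frob_mult j *: phi w))).

(** If d z = f w1 then d (z ^ p) = f ^ p w1 ^ p = f (f ^ (p - 1) w1 ^ p), so that
    Frobenius acquires the factor f ^ (p - 1). *)
Lemma linkedS j (z w1 w : C) : (j < c)%N -> (j < m)%N -> part (m - j.+1) z = z ->
  M j (d z - f j *: w1) -> linked j w1 w -> linked j.+1 z w.
Proof.
move=> hj hjm hz hzw hl h; have hM := @seq_mod_submodule S C f j.
have conn (x v : C) : part (m - j.+1) x = x -> M j (d x - f j *: v) ->
    bdry_mod d (M j.+1) x <-> bdry_mod d (M j) v.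
  move=> hx hxv.
  apply: (@connecting S C d (@cech_d2 _ _ _) (M j) (f j) hM _ _ (part (m - j.+1))) => //.
  - move=> y; exact: (seq_mod_linear d).
  - by apply: seq_mod_cech_regular => a; exact: f_reg.
  - move=> y; exact: (seq_mod_linear (part _)).
  by apply: (cech_acyclic f_reg); lia.
have dphi y : d (phi y) = phi (d y) by exact: (cech_frob_d p_pr p0).
split.
  rewrite (conn (h *: z) (h *: w1)); first by case: (hl h).
    by rewrite (linearZZ (part _)) /= hz.
  rewrite (linearZZ d) /= [f j *: _]scalerA mulrC -scalerA -scalerBr.
  exact: submoduleZ.
rewrite (conn (h *: phi z) ((h * f j ^+ p.-1) *: phi w1)).
- have [_ ->] := hl (h * f j ^+ p.-1); rewrite !scalerA.
  by rewrite /frob_mult big_ord_recr /= -mulrA [f j ^+ _ * _]mulrC.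
- by rewrite (linearZZ (part _)) /= -cech_frob_part hz.
rewrite (linearZZ d) /= dphi [f j *: _]scalerA mulrCA -exprS prednK ?prime_gt0 //.
rewrite -scalerA -scalerBr -cech_frobZ -phiB.
by apply: submoduleZ => //; exact: seq_mod_frob.
Qed.

Lemma cech_d_top (w : C) : part m w = w -> d w = 0.
Proof.
move=> hw; rewrite -hw -cech_part_d; apply/ffunP=> A; rewrite cech_partE cech0E.
by case: eqP => // h; have := max_card (mem A); rewrite h card_ord ltnn.
Qed.

Lemma linked0 (w : C) : linked 0 w w.
Proof. by move=> h; split=> //; rewrite /frob_mult big_ord0 scale1r. Qed.

Definition shift_deg (T : pred int) (D : nat) : pred int := fun s => T (s + D%:Z).

Lemma link_up j (T : pred int) (z : C) : (j <= c)%N -> (j <= m)%N ->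
  part (m - j) z = z -> degrees_in T z -> M j (d z) ->
  exists w, [/\ part m w = w, degrees_in (shift_deg T (\sum_(i < j) e i)%N) w & linked j z w].
Proof.
elim: j T z => [|j ih] T z hj hjm hz hT dz.
  exists z; rewrite subn0 in hz; split=> //; last exact: linked0.
  by rewrite big_ord0; apply: degrees_in_sub hT => s; rewrite /shift_deg addr0.
have hM := @seq_mod_submodule S C f j.
(* projecting y makes the degrees of w1 exact and keeps it a cocycle modulo M j *)
have [y hy] := dz; pose w1 := part (m - j) (cech_restrict (shift_deg T (e j)) y).
have mj : (m - j = (m - j.+1).+1)%N by lia.
have hzw : M j (d z - f j *: w1).
  have -> : d z - f j *: w1 = part (m - j) (cech_restrict T (d z - f j *: y)).
    rewrite cech_restrictB (raddfB (part _)) /= cech_restrict_d hT.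
    rewrite {1}mj cech_part_d hz (cech_restrictZ _ _ (f_homog hj)).
    by rewrite (linearZZ (part _)).
  apply: (seq_mod_linear (part _)); apply: (@seq_mod_restrict _ _ _ e) => //.
  by move=> i hi; apply: f_homog; exact: ltn_trans hi hj.
have reg : regular_mod (M j) (f j).
  by apply: seq_mod_cech_regular => a; exact: f_reg.
have dw1 : M j (d w1).
  apply: reg; rewrite -(linearZZ d) /=.
  have -> : d (f j *: w1) = - d (d z - f j *: w1).
    by rewrite (raddfB d) /= cech_d2 sub0r opprK.
  by apply: submoduleN => //; exact: (seq_mod_linear d).
have [||w [h1 h2 h3]] := ih (shift_deg T (e j)) w1 (ltnW hj) (ltnW hjm) _ _ dw1.
- exact: cech_part_id.
- by rewrite /degrees_in /w1 cech_restrict_part; congr part; exact: degrees_in_restrict.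
exists w; split=> //; last exact: (linkedS hj hjm hz hzw h3).
apply: degrees_in_sub h2 => s; rewrite /shift_deg big_ord_recr /=.
by rewrite -addrA -PoszD.
Qed.

(** The classes of H^m(C) killed by f 0, ..., f (j - 1) are in the image: f j kills
    the class w1 already obtained, and a primitive of f j w1 lifts it once more. *)
Lemma link_down j (T : pred int) (w : C) : (j <= c)%N -> (j <= m)%N ->
  part m w = w -> degrees_in (shift_deg T (\sum_(i < j) e i)%N) w ->
  (forall i, (i < j)%N -> bdry_mod d (M 0) (f i *: w)) ->
  exists z, [/\ part (m - j) z = z, degrees_in T z, M j (d z) & linked j z w].
Proof.
elim: j T w => [|j ih] T w hj hjm hw hT fw.
  exists w; rewrite subn0; split=> //; last exact: linked0.
    by apply: degrees_in_sub hT => s; rewrite /shift_deg big_ord0 addr0.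
  exact: cech_d_top.
have hM := @seq_mod_submodule S C f j.
have [||w1 [h1 h2 h3 h4]] := ih (shift_deg T (e j)) w (ltnW hj) (ltnW hjm) hw.
- apply: degrees_in_sub hT => s; rewrite /shift_deg big_ord_recr /=.
  by rewrite -addrA -PoszD.
- by move=> i hi; apply: fw; exact: ltnW.
have mj : (m - j = (m - j.+1).+1)%N by lia.
have [y hy] : bdry_mod d (M j) (f j *: w1) by apply/(h4 (f j)).1/fw.
pose z := part (m - j.+1) (cech_restrict T y).
have hz : part (m - j.+1) z = z by exact: cech_part_id.
have hzw : M j (d z - f j *: w1).
  have -> : d z - f j *: w1 = - part (m - j) (cech_restrict T (f j *: w1 - d y)).
    rewrite cech_restrictB (raddfB (part _)) /= cech_restrict_d opprB.
    rewrite {1}mj cech_part_d (cech_restrictZ _ _ (f_homog hj)) h2.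
    by rewrite (linearZZ (part _)) /= h1.
  apply: submoduleN => //.
  apply: (seq_mod_linear (part _)); apply: (@seq_mod_restrict _ _ _ e) => //.
  by move=> i hi; apply: f_homog; exact: ltn_trans hi hj.
exists z; split=> //; last exact: (linkedS hj hjm hz hzw h4).
  by rewrite /degrees_in /z cech_restrict_part; congr part; exact: degrees_in_restrict.
by exists w1.
Qed.
End Links.

(** * Frobenius on the cohomology of a complete intersection *)

Section CompleteIntersection.
Variables (k : fieldType) (m : nat) (p : nat) (charp : p \in [pchar k]).
Local Notation S := {mpoly k[m]}.
Local Notation X := (fun i : 'I_m => 'X_i : S).
Local Notation C := (cech X).
Local Notation d := (@cech_d S m X).
Local Notation part := (@cech_part S m X).
Local Notation phi := (@cech_frob S m X p).

Definition top_cochain N a : C :=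
  [ffun A : {set 'I_m} => if A == setT then frac (xprod X A) a N else 0].

Lemma top_cochainE N a (A : {set 'I_m}) :
  top_cochain N a A = if A == setT then frac (xprod X A) a N else 0.
Proof. by rewrite ffunE. Qed.

Lemma cardsT_eq (A : {set 'I_m}) : (#|A| == m) = (A == [set: 'I_m]).
Proof.
apply/eqP/eqP=> [h|->]; last by rewrite cardsT card_ord.
by apply/eqP; rewrite eqEcard subsetT cardsT card_ord h leqnn.
Qed.

Lemma top_cochain_part N a : part m (top_cochain N a) = top_cochain N a.
Proof.
by apply/ffunP=> A; rewrite cech_partE cardsT_eq top_cochainE; case: eqP.
Qed.

Lemma top_cochain_surj (w : C) : part m w = w -> exists N a, w = top_cochain N a.
Proof.
move=> hw; exists (repr (w setT)).2, (repr (w setT)).1.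
apply/ffunP=> A; rewrite -hw cech_partE cardsT_eq top_cochainE; case: eqP => // ->.
by rewrite -fracE hw.
Qed.

Lemma top_cochain_bdry (f : nat -> S) h N a :
  bdry_mod d (seq_mod f 0) (h *: top_cochain N a) <-> var_power_ideal N (h * a).
Proof.
rewrite -(@top_boundaryP _ _ (h *: top_cochain N a)).
- by split=> -[y] => [/eqP|/eqP]; [rewrite subr_eq0 => /eqP | rewrite -subr_eq0 => /eqP]; exists y.
- by move=> A /negbTE hA; rewrite cech_scaleE top_cochainE hA mulr0.
by rewrite cech_scaleE top_cochainE eqxx fracMl.
Qed.

Lemma top_cochain_frob N a : phi (top_cochain N a) = top_cochain (N * p) (a ^+ p).
Proof.
apply/ffunP=> A; rewrite ffunE !top_cochainE; case: eqP => _; first by rewrite fracX.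
by rewrite expr0n gtn_eqF ?prime_gt0 ?(pcharf_prime charp).
Qed.

Lemma top_cochain_degrees (T : pred int) N a :
  (forall b, b \in msupp a -> T ((mdeg b)%:Z - (N * m)%:Z)) -> degrees_in T (top_cochain N a).
Proof.
move=> h; apply/ffunP=> A; rewrite cech_restrictE top_cochainE.
case: eqP => [->|_]; last exact: loc_restrict0.
rewrite loc_restrictE; congr frac; apply/mpolyP=> b; rewrite mcoeff_restrict_deg.
rewrite cardsT card_ord; case: ifPn => // hb; apply/esym.
by apply: memN_msupp_eq0; apply: contra hb; exact: h.
Qed.

Variables (c : nat) (f : nat -> S) (e : nat -> nat).
Hypotheses (f_homog : forall i, (i < c)%N -> f i \is (e i).-homog)
  (e_gt0 : forall i, (i < c)%N -> (0 < e i)%N)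
  (f_reg : forall i a, (i < c)%N -> ideal_chain f i (f i * a) -> ideal_chain f i a).
Local Notation M := (@seq_mod S C f).

(** The class of 1 / (x_0 ... x_(m-1)) is killed by every form of positive degree.
    If c > m it would come from some z in degree 0 outside (f 0, ..., f (m - 1))
    with f m z inside. *)
Lemma regular_chain_length : (c <= m)%N.
Proof.
rewrite leqNgt; apply/negP => hmc.
have hf i : (i < c)%N -> var_power_ideal 1 (f i * 1).
  move=> hi b hb; rewrite mulr1; apply: (dhomog_nemf_coeff (f_homog hi)).
  have -> : b = 0%MM by apply/mnmP=> l; rewrite mnm0E; have := hb l; rewrite ltnS leqn0 => /eqP.
  by rewrite /= mdeg0 eq_sym -lt0n e_gt0.
pose w := top_cochain 1 1.
have f_homog' i : (i < m)%N -> f i \is (e i).-homog by move=> h; apply: f_homog; lia.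
have f_reg' i a : (i < m)%N -> ideal_chain f i (f i * a) -> ideal_chain f i a.
  by move=> h; apply: f_reg; lia.
have [|||z [hz _ _ hl]] := @link_down k m p charp m f e f_homog' f_reg' m xpredT w (leqnn _) (leqnn _).
- exact: top_cochain_part.
- exact: top_cochain_degrees.
- by move=> i hi; apply/top_cochain_bdry/hf; lia.
rewrite subnn in hz.
have [y hy] : bdry_mod d (M m) (f m *: z) by apply/(hl _).1/top_cochain_bdry/hf.
have {y}hy : M m (f m *: z).
  have := seq_mod_linear (part 0) hy.
  by rewrite (raddfB (part 0)) /= cech_part0_d subr0 (linearZZ (part 0)) /= hz.
have {}hy : M m z.
  by move: hy; apply: seq_mod_cech_regular => a; exact: f_reg.
have /(hl 1).1/top_cochain_bdry : bdry_mod d (M m) (1 *: z).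
  by rewrite scale1r; apply: bdry_modW => //; exact: seq_mod_submodule.
move=> /(_ 0%MM); rewrite mulr1 mcoeff1 eqxx => h.
have /eqP := h (fun i => ltac:(by rewrite mnm0E)).
by rewrite oner_eq0.
Qed.

Lemma negative_degree_cochain0 (T : pred int) (z : C) : (forall s : int, T s -> s < 0) ->
  part 0 z = z -> degrees_in T z -> z = 0.
Proof.
move=> hT hz hd; apply/ffunP=> A; rewrite -hz cech_partE cech0E.
case: eqP => // /eqP; rewrite cards_eq0 => /eqP eA.
rewrite -hd cech_restrictE; elim/fracW: (z A) => a N.
rewrite loc_restrictE -(frac0 _ N); congr frac; apply/mpolyP=> b.
rewrite mcoeff_restrict_deg mcoeff0; case: ifP => // /hT.
by rewrite eA cards0 muln0 subr0.
Qed.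

Section Generators.
Variables (r : nat) (g : 'I_r -> S) (eg : 'I_r -> nat) (D : nat).
Hypotheses (g_homog : forall l, g l \is (eg l).-homog) (eg_le : forall l, (eg l <= D)%N)
  (g_unit : forall i : 'I_m, exists N (a : 'I_r -> S), 'X_i ^+ N = \sum_l a l * g l).

(** The zigzag, run from Cech degree m - c to Cech degree 0, raises the degrees by
    at most (m - c) * D, hence ends in negative degrees. *)
Lemma cech_koszul_killed (t : int) (z : C) :
  t + ((m - c) * D)%:Z <= 0 -> part (m - c) z = z -> degrees_in (fun s => s < t) z ->
  M c (d z) -> (forall l, bdry_mod d (M c) (g l *: z)) -> bdry_mod d (M c) z.
Proof.
move=> ht hz hd dz gz; have hcm := regular_chain_length.
have hM := @seq_mod_submodule S C f c.
have [q0|q0] := posnP (m - c).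
  rewrite (@negative_degree_cochain0 (fun s => s < t) z) //.
  - by apply: bdry_modW => //; exact: submodule0.
  - by move=> s; rewrite q0 mul0n addr0 in ht => /lt_le_trans; apply.
  by rewrite q0 in hz.
have [N hN] := choice g_unit; have [a ha] := choice hN.
(* coefficients of a relation sum_l u l A * g l = 1 over each A <> set0 *)
pose u l (A : {set 'I_m}) : loc (xprod X A) :=
  if [pick i in A] is Some i then frac _ (a i l * xprod X (A :\ i) ^+ N i) (N i) else 0.
pose al l := cech_mult (u l) : {linear C -> C}.
have alE (y : C) : y set0 = 0 -> \sum_l al l (g l *: y) = y.
  move=> y0; apply/ffunP=> A; rewrite cech_sumE.
  under eq_bigr => l _ do rewrite cech_multE cech_scaleE mulrA.
  rewrite -mulr_suml /u; case: pickP => [i iA|hA]; last first.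
    have -> : A = set0 by apply/setP=> i; rewrite hA inE.
    by rewrite y0 mulr0.
  under eq_bigr => l _ do rewrite fracM addn0 mulrAC.
  rewrite frac_sum -mulr_suml -ha.
  have -> : 'X_i ^+ N i * xprod X (A :\ i) ^+ N i = xprod X A ^+ N i :> S.
    by rewrite -exprMn {2}/xprod (big_setD1 i).
  suff -> : frac (xprod X A) (xprod X A ^+ N i) (N i) = 1 by rewrite mul1r.
  by rewrite -[X in frac _ X _]mulr1 -[X in frac _ _ X]addn0 frac_shift frac1.
pose H i j (y : C) := part i y = y /\ degrees_in (fun s => s < t + (j * D)%:Z) y.
apply: (@zigzag_killed S C d (@cech_d2 _ _ _) r g al (M c) (m - c) H) => //.
- by move=> y; exact: (seq_mod_linear d).
- by move=> l y; exact: (seq_mod_linear (al l)).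
- move=> y; apply: alE; rewrite cech_dE big_pred0 // => i; by rewrite inE.
- move=> i j y y' [h1 h2] [h1' h2']; split; last exact: degrees_inB.
  by rewrite (raddfB (part i)) /= h1 h1'.
- move=> i j l y [h1 h2]; split; first by rewrite (linearZZ (part i)) /= h1.
  apply: (degrees_inZ (g_homog l)); apply: degrees_in_sub h2 => s.
  by have := eg_le l; rewrite mulSn; lia.
- move=> i j y [h1 _]; apply: alE; by rewrite -h1 cech_partE cards0.
- move=> i j y [h1 h2] [y0 hy0].
  exists (part i (cech_restrict (fun s => s < t + (j * D)%:Z) y0)).
    split; first exact: cech_part_id.
    by rewrite /degrees_in cech_restrict_part; congr part; exact: degrees_in_restrict.
  have -> : y - d (part i (cech_restrict (fun s => s < t + (j * D)%:Z) y0)) =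
     part i.+1 (cech_restrict (fun s => s < t + (j * D)%:Z) (y - d y0)).
    by rewrite cech_restrictB (raddfB (part _)) /= cech_restrict_d h2 cech_part_d h1.
  by apply: (seq_mod_linear (part _)); exact: (@seq_mod_restrict _ _ _ e).
- move=> i j y hi [h1 h2] dy; rewrite -h1.
  by apply: (cech_acyclic f_reg (leqnn c) _ dy); lia.
- move=> y [h1 h2]; apply: negative_degree_cochain0 h1 h2 => s hs.
  exact: lt_le_trans hs ht.
by split=> //; rewrite mul0n addr0.
Qed.

Local Notation U := (frob_mult p f c).

Lemma cech_frob_injective (t : int) (z : C) :
  (forall N a, (forall i, (i < c)%N -> var_power_ideal N (f i * a)) ->
     var_power_ideal (N * p) (U * a ^+ p) -> forall l, var_power_ideal N (g l * a)) ->
  t + ((m - c) * D)%:Z <= 0 -> part (m - c) z = z -> degrees_in (fun s => s < t) z ->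
  M c (d z) -> bdry_mod d (M c) (phi z) -> bdry_mod d (M c) z.
Proof.
move=> hg ht hz hd dz phiz.
have [w [hw _ hl]] := link_up charp f_homog f_reg (leqnn c) regular_chain_length hz hd dz.
have [N [a wE]] := top_cochain_surj hw.
apply: (cech_koszul_killed ht) => // l; apply/(hl _).1; rewrite wE.
apply/top_cochain_bdry/hg => [i hi|].
  apply/(@top_cochain_bdry f); rewrite -wE; apply/(hl _).1.
  apply: bdry_modW; first exact: seq_mod_submodule.
  exact: seq_mod_gen.
apply/(@top_cochain_bdry f); rewrite -top_cochain_frob -wE -[X in X *: _]mul1r -scalerA.
by apply/(hl _).2; rewrite scale1r.
Qed.
End Generators.

Local Notation U := (frob_mult p f c).

Lemma cech_frob_kernel (N : nat) (a : S) (s : int) :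
  (forall b, b \in msupp a -> (mdeg b)%:Z - (N * m)%:Z = s) ->
  (forall i, (i < c)%N -> var_power_ideal N (f i * a)) ->
  var_power_ideal (N * p) (U * a ^+ p) -> ~ var_power_ideal N a ->
  exists z : C, [/\ part (m - c) z = z,
     degrees_in (pred1 (s + (\sum_(i < c) e i)%N%:Z)) z, M c (d z),
     bdry_mod d (M c) (phi z) & ~ bdry_mod d (M c) z].
Proof.
move=> ha fa Ua na; pose s0 : int := s + (\sum_(i < c) e i)%N%:Z.
have [|||z [hz hd dz hl]] := @link_down k m p charp c f e f_homog f_reg c
   (pred1 s0) (top_cochain N a) (leqnn _) regular_chain_length.
- exact: top_cochain_part.
- by apply: top_cochain_degrees => b /ha h; rewrite /shift_deg /= h eqxx.
- by move=> i hi; apply/top_cochain_bdry/fa.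
exists z; split=> //.
  rewrite -[phi z]scale1r; apply/(hl 1).2; rewrite scale1r top_cochain_frob.
  exact/top_cochain_bdry.
rewrite -[z]scale1r => /(hl 1).1/top_cochain_bdry; by rewrite mul1r.
Qed.
End CompleteIntersection.

(** * Generators of tau and Macaulay duality *)

Section IdealGen.
Variable R : comNzRingType.
Implicit Types (I Y : R -> Prop).

Lemma is_ideal_sum I (T : Type) (r : seq T) (F : T -> R) :
  is_ideal I -> (forall i, I (F i)) -> I (\sum_(i <- r) F i).
Proof. by move=> [h0 hD _] h; elim/big_rec: _ => // i y _; exact: hD. Qed.

Lemma ideal_gen_is_ideal Y : is_ideal (ideal_gen Y).
Proof.
split.
- by exists 0%N, (fun=> 0), (fun=> 0); rewrite big_ord0; split=> // -[].
- move=> _ _ [r [a [b [hb ->]]]] [r' [a' [b' [hb' ->]]]].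
  exists (r + r')%N, (fun l => match split l with inl i => a i | inr i => a' i end),
    (fun l => match split l with inl i => b i | inr i => b' i end); split.
    by move=> l; case: (split l).
  rewrite big_split_ord; congr (_ + _); apply: eq_bigr => i _.
    by rewrite (unsplitK (inl i)).
  by rewrite (unsplitK (inr i)).
move=> c _ [r [a [b [hb ->]]]]; exists r, (fun l => c * a l), b; split=> //.
by rewrite mulr_sumr; apply: eq_bigr => l _; rewrite mulrA.
Qed.

Lemma ideal_gen_sub Y g : Y g -> ideal_gen Y g.
Proof. by exists 1%N, (fun=> 1), (fun=> g); rewrite big_ord1 mul1r. Qed.

Lemma ideal_gen_min Y I : is_ideal I -> (forall g, Y g -> I g) -> forall g, ideal_gen Y g -> I g.
Proof.
move=> idI hY _ [r [a [b [hb ->]]]]; apply: is_ideal_sum => // l.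
by case: (idI) => _ _ hM; exact/hM/hY.
Qed.
End IdealGen.

Section Tau.
Variables (k : fieldType) (m p : nat) (charp : p \in [pchar k]).
Local Notation S := {mpoly k[m]}.
Variables (c : nat) (f : nat -> S) (e : nat -> nat).
Hypothesis f_homog : forall i, (i < c)%N -> f i \is (e i).-homog.
Local Notation U := (frob_mult p f c).
Local Notation D := (\sum_(i < c) e i)%N.
Variable tau : S -> Prop.
Hypotheses (tau_ideal : is_ideal tau) (tau_f : forall i, (i < c)%N -> tau (f i))
  (tau_U : frob_power p tau U)
  (tau_min : forall I, is_ideal I -> (forall i, (i < c)%N -> I (f i)) -> frob_power p I U ->
     forall g, tau g -> I g).

Lemma frob_mult_homog : U \is (D * p.-1)%N.-homog.
Proof.
rewrite /frob_mult; elim: c f_homog => [|j ih] hf; first by rewrite !big_ord0 dhomog1.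
rewrite !big_ord_recr /= mulnDl; apply: dhomogM; last exact/dhomogMn/hf.
by apply: ih => i hi; apply: hf; exact: ltnW.
Qed.

(** The Cartier components of U = sum_l (u_l) ^ p b_l lie in every ideal I with U
    in its Frobenius power, by p^-1-linearity; together with the f i they span an
    ideal with that property, which is therefore tau.  The Cartier components have
    degree at most D * (p - 1) / p. *)
Lemma tau_generators : finite_over_pth_powers k p ->
  exists (r : nat) (g : 'I_r -> S) (eg : 'I_r -> nat),
    [/\ forall l, g l \is (eg l).-homog, forall l, (eg l <= D)%N,
        forall h, tau h <-> exists a : 'I_r -> S, h = \sum_l a l * g l
      & forall N a, (forall i, (i < c)%N -> var_power_ideal N (f i * a)) ->
          var_power_ideal (N * p) (U * a ^+ p) -> forall l, var_power_ideal N (g l * a)].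
Proof.
move=> /(pth_power_coordinates charp)[r0 [b [kap [kapD kapZ kapE]]]].
have p_pr := pcharf_prime charp; have p_gt0 := prime_gt0 p_pr.
pose T : finType := ('I_c + 'I_r0 * {ffun 'I_m -> 'I_p})%type.
pose G (t : T) : S := match t with
  | inl i => f i | inr (l, al) => cartier p (kap l) (small_exponent al) U end.
pose E (t : T) : nat := match t with
  | inl i => e i | inr (l, al) => ((D * p.-1 - mdeg (small_exponent al)) %/ p)%N end.
have al_lt al i : (@small_exponent m p al i < p)%N by exact: small_exponent_lt.
have tauG t : tau (G t).
  case: t => [i|[l al]] /=; first exact: tau_f.
  have [q [a [x [hx ->]]]] := tau_U.
  have cD := cartierD charp (small_exponent al) (kapD l).
  have c0 : cartier p (kap l) (small_exponent al) 0 = 0 :> S.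
    by apply: (addrI (cartier p (kap l) (small_exponent al) 0)); rewrite -cD !addr0.
  rewrite (big_morph _ cD c0); apply: is_ideal_sum => // i.
  have [y ty ->] := hx i; rewrite (cartierM charp (kapD l) (kapZ l) (al_lt al)).
  by case: tau_ideal => _ _ hM; exact: hM.
pose tau0 (h : S) := exists a : 'I_#|T| -> S, h = \sum_l a l * G (enum_val l).
have tau0_ideal : is_ideal tau0.
  split.
  - by exists (fun=> 0); rewrite big1 // => l _; rewrite mul0r.
  - move=> _ _ [a ->] [a' ->]; exists (fun l => a l + a' l).
    by rewrite -big_split; apply: eq_bigr => l _; rewrite mulrDl.
  move=> h _ [a ->]; exists (fun l => h * a l).
  by rewrite mulr_sumr; apply: eq_bigr => l _; rewrite mulrA.
have tau0G t : tau0 (G t).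
  exists (fun l => (l == enum_rank t)%:R).
  rewrite (bigD1 (enum_rank t)) //= eqxx enum_rankK mul1r big1 ?addr0 //.
  by move=> l /negbTE->; rewrite mul0r.
have tauE h : tau h <-> tau0 h.
  split=> [|[a ->]].
    apply: tau_min => // [i hi|]; first exact: (tau0G (inl (Ordinal hi))).
    rewrite [U](cartier_decomposition charp kapD kapE).
    have fid := ideal_gen_is_ideal (fun b => exists2 a, tau0 a & b = a ^+ p).
    do 2!apply: is_ideal_sum => // ?; case: (fid) => _ _ hM; rewrite mulrC; apply: hM.
    apply: ideal_gen_sub; eexists; last by []; exact: (tau0G (inr (_, _))).
  by apply: is_ideal_sum => // l; case: (tau_ideal) => _ _ hM; apply: hM.
exists #|T|, (fun l => G (enum_val l)), (fun l => E (enum_val l)); split=> //.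
- move=> l; case: (enum_val l) => [i|[l' al]] /=; first exact: f_homog.
  exact: (cartier_homog charp _ (kapD l') frob_mult_homog).
- move=> l; case: (enum_val l) => [i|[l' al]] /=.
    by rewrite (bigD1 i) //= leq_addr.
  have h : (D * p.-1 <= D * p)%N by rewrite leq_mul2l leq_pred orbT.
  apply: leq_trans (leq_div2r p (leq_trans (leq_subr _ _) h)) _; by rewrite mulnK.
move=> N a fa Ua l; case: (enum_val l) => [i|[l' al]] /=; first exact: fa.
rewrite -(cartierM charp (kapD l') (kapZ l') (al_lt al)).
exact: (cartier_var_power_ideal charp (kapD l') (al_lt al)).
Qed.
End Tau.

Section InverseSystem.
Variables (k : fieldType) (m : nat).
Local Notation S := {mpoly k[m]}.
Variable I : S -> Prop.
Hypotheses (I_ideal : is_ideal I) (I_graded : forall D h, I h -> I (restrict_deg D h)).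

(** Macaulay duality: with the socle monomial 'X_[top] modulo
    (x_0 ^ (R + 1), ..., x_(m-1) ^ (R + 1)), a linear form lam on the polynomials of
    degree R is a = sum_t lam t 'X_[top - t], and the coefficient of h a at b is
    the value of lam at h 'X_[top - b]. *)
Lemma inverse_system_nonzero (b0 : 'X_{1..m}) (R := mdeg b0) : ~ I 'X_[b0] ->
  exists a : S,
    [/\ forall b, b \in msupp a -> (mdeg b + R = R * m)%N,
        forall h, I h -> var_power_ideal R.+1 (h * a)
      & ~ var_power_ideal R.+1 a].
Proof.
have [I0 ID IM] := I_ideal => nb0.
pose T : finType := 'X_{1..m < R.+1}.
pose vec (h : S) (t : T) : k := if mdeg t == R then h@_t else 0.
pose W (v : T -> k) := exists2 h, I h & v = vec h.
have [||||lam [lamW lamv]] := @separating_functional k T W _ _ _ (vec 'X_[b0]).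
- by exists 0 => //; apply: funext => t; rewrite /vec mcoeff0 if_same.
- move=> _ _ [h hh ->] [h' hh' ->]; exists (h + h'); first exact: ID.
  by apply: funext => t; rewrite /vec mcoeffD; case: ifP; rewrite ?addr0.
- move=> a _ [h hh ->]; exists (a *: h); first by rewrite -mul_mpolyC; exact: IM.
  by apply: funext => t; rewrite /vec mcoeffZ; case: ifP; rewrite ?mulr0.
- move=> [h hh hE]; apply: nb0.
  have -> : 'X_[b0] = restrict_deg (pred1 R) h.
    apply/mpolyP=> b; rewrite mcoeff_restrict_deg /=; have [bR|bR] := eqVneq (mdeg b) R.
      have hb : (mdeg b < R.+1)%N by rewrite bR.
      by have := congr1 (fun v => v (BMultinom hb)) hE; rewrite /vec /= bR eqxx.
    by rewrite mcoeffX; case: eqP => // eb; rewrite -eb /R eqxx in bR.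
  exact: I_graded.
pose top : 'X_{1..m} := [multinom R | i < m].
have topE i : top i = R by rewrite mnmE.
have le_top (t : 'X_{1..m}) : mdeg t = R -> (t <= top)%MM.
  move=> tR; apply/mnm_lepP=> i; rewrite topE -tR mdegE.
  by rewrite (bigD1 i) //= leq_addr.
have top_sub (t b : 'X_{1..m}) : (t <= top)%MM -> (b <= top)%MM ->
    (top - t == top - b)%MM = (t == b).
  move=> /mnm_lepP ht /mnm_lepP hb; apply/eqP/eqP=> [/mnmP h|->//]; apply/mnmP=> i.
  have := h i; have := ht i; have := hb i; rewrite !mnmBE; lia.
pose a : S := \sum_(t : T | mdeg t == R) lam t *: 'X_[top - t].
exists a; split.
- have degtop : mdeg top = (R * m)%N.
    by rewrite mdegE; under eq_bigr do rewrite topE; rewrite sum_nat_const card_ord mulnC.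
  have : a \is (R * m - R)%N.-homog.
    apply: rpred_sum => t /eqP tR; apply: rpredZ; rewrite dhomogX /= -degtop.
    by have := mdegD (top - t) t; rewrite submK ?le_top // tR => ->; rewrite addnK.
  move=> /dhomogP ha b /ha /= ->; rewrite subnK //.
  by rewrite -degtop; have := mdegD (top - b0) b0; rewrite submK ?le_top // => ->; exact: leq_addl.
- move=> h hh b hb.
  have btop : (b <= top)%MM by apply/mnm_lepP=> i; rewrite topE -ltnS.
  have hW : W (vec ('X_[top - b] * h)) by exists ('X_[top - b] * h) => //; exact: IM.
  rewrite -(lamW _ hW) mulr_sumr raddf_sum big_mkcond; apply: eq_bigr => t _ /=; rewrite /vec.
  case: eqP => [tR|]; last by rewrite mulr0.
  have /mnm_lepP tt := le_top t tR; move/mnm_lepP: (btop) => bt.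
  rewrite -scalerAr mcoeffZ mcoeffMXE [_ * h]mulrC mcoeffMXE.
  have -> : (top - t <= b)%MM = (top - b <= t)%MM.
    apply/mnm_lepP/mnm_lepP => hi i; have := hi i; have := tt i; have := bt i;
      rewrite !mnmBE; lia.
  case: ifP => // _; congr (_ * _@__); apply/mnmP=> i.
  by have := tt i; have := bt i; rewrite !mnmBE; lia.
move=> /(_ (top - b0)%MM) h; apply: lamv; rewrite -[RHS]h => [|i]; last first.
  by rewrite mnmBE topE ltnS leq_subr.
rewrite raddf_sum [in RHS]big_mkcond; apply: eq_bigr => t _ /=; rewrite /vec.
case: eqP => [tR|]; last by rewrite mulr0.
by rewrite mcoeffZ !mcoeffX top_sub ?le_top // eq_sym.
Qed.
End InverseSystem.

(** * When tau is primary to the irrelevant ideal *)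

Section Primary.
Variables (k : fieldType) (n : nat).
Local Notation S := {mpoly k[n.+1]}.

Lemma irrelevant_idealP (g : S) : irrelevant_ideal g <-> g@_0%MM = 0.
Proof.
split=> [[r [a [b [hb ->]]]]|g0].
  rewrite raddf_sum big1 // => l _ /=; have [i ->] := hb l.
  by rewrite mcoeffMXE lep1mP mnm0E.
have [|a ->] := @var_power_ideal_split k n.+1 1 g.
  move=> b hb; rewrite (_ : b = 0%MM) //; apply/mnmP=> i; rewrite mnm0E.
  by have := hb i; rewrite ltnS leqn0 => /eqP.
exists n.+1, a, (fun i => 'X_i); split; first by move=> l; exists l.
by apply: eq_bigr => j _; rewrite expr1 mulrC.
Qed.

Lemma mcoeff_pow_low (g : S) N b : g@_0%MM = 0 -> (mdeg b < N)%N -> (g ^+ N)@_b = 0.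
Proof.
move=> g0; elim: N b => [//|N ih] b; rewrite ltnS => hb.
rewrite exprS mulrC mcoeffM_supp big_seq big1 // => c hc.
case: ifP; rewrite ?mulr0 // => cb; rewrite ih ?mulr0 //.
have hc0 : (0 < mdeg c)%N.
  by rewrite lt0n mdeg_eq0; apply: contraTneq hc => ->; rewrite mcoeff_msupp g0 eqxx.
apply: leq_trans hb; rewrite -[in X in (_ < X)%N](submK cb) mdegD.
by rewrite -[X in (X < _)%N]addn0 ltn_add2l.
Qed.

Variable I : S -> Prop.
Hypotheses (I_ideal : is_ideal I) (I_graded : forall D h, I h -> I (restrict_deg D h)).

(** An element of the radical has no constant term, since I would contain the
    degree 0 part of one of its powers, a unit; and monomials of large degree
    are multiples of high powers of variables. *)
Lemma radical_irrelevantP : ~ (forall g, I g) ->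
  (forall g, radical I g <-> irrelevant_ideal g) <->
  forall i : 'I_n.+1, exists N, I ('X_i ^+ N).
Proof.
have [I0 ID IM] := I_ideal => Iprop; split=> [h i|h g].
  by apply/h/irrelevant_idealP; rewrite mcoeffX -mdeg_eq0 mdeg1.
split=> [[N hN]|/irrelevant_idealP g0].
  apply/irrelevant_idealP; apply: contrapT => g0; apply: Iprop => a.
  have {}hN := I_graded (pred1 0%N) hN.
  have eg : restrict_deg (pred1 0%N) (g ^+ N) = (g@_0%MM ^+ N)%:MP.
    apply/mpolyP=> b; rewrite mcoeff_restrict_deg mcoeffC /= mdeg_eq0.
    by case: eqP => [->|_]; rewrite ?mulr0 // mulr1 rmorphXn.
  have -> : a = (a * ((g@_0%MM ^+ N)^-1)%:MP) * restrict_deg (pred1 0%N) (g ^+ N).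
    rewrite eg -mulrA -mpolyCM mulVf ?mulr1 // expf_neq0 //; exact/eqP.
  exact: IM.
have [N hN] := choice h; pose K := (\max_i N i)%N.
exists (n.+1 * K)%N; rewrite [g ^+ _]mpolyE big_seq.
elim/big_rec: _ => // b y hb hy; apply: ID => //; rewrite -mul_mpolyC; apply: (IM).
have hbK : (n.+1 * K <= mdeg b)%N.
  rewrite leqNgt; apply/negP => hlt; move: hb.
  by rewrite mcoeff_msupp mcoeff_pow_low ?eqxx.
have [i hi] : exists i, (N i <= b i)%N.
  apply: contrapT => hn; move: hbK; rewrite leqNgt => /negP; apply.
  have hlt i : (b i < N i)%N by rewrite ltnNge; apply/negP => hi; apply: hn; exists i.
  have leK i : (N i <= K)%N by exact: leq_bigmax.
  have K0 : (0 < K)%N := leq_trans (leq_ltn_trans (leq0n _) (hlt ord0)) (leK ord0).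
  rewrite mdegE; apply: (@leq_ltn_trans (\sum_(i < n.+1) K.-1)%N).
    apply: leq_sum => i _; rewrite -ltnS prednK //.
    exact: leq_trans (hlt i) (leK i).
  by rewrite sum_nat_const card_ord ltn_pmul2l // prednK.
rewrite -(@submK _ (U_(i) *+ N i)%MM b) ?mpolyXD; last first.
  by apply/mnm_lepP=> j; rewrite mulmnE mnm1E; case: eqP => [<-|]; rewrite ?mul1n.
by rewrite -mpolyXn; exact: (IM).
Qed.
End Primary.

Section TauPrimary.
Variables (k : fieldType) (m p : nat) (charp : p \in [pchar k]).
Hypothesis kfin : finite_over_pth_powers k p.
Local Notation S := {mpoly k[m]}.
Local Notation X := (fun i : 'I_m => 'X_i : S).
Local Notation C := (cech X).
Local Notation d := (@cech_d S m X).
Local Notation part := (@cech_part S m X).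
Local Notation phi := (@cech_frob S m X p).
Variables (c : nat) (f : nat -> S) (e : nat -> nat).
Hypotheses (f_homog : forall i, (i < c)%N -> f i \is (e i).-homog)
  (e_gt0 : forall i, (i < c)%N -> (0 < e i)%N)
  (f_reg : forall i a, (i < c)%N -> ideal_chain f i (f i * a) -> ideal_chain f i a).
Local Notation M := (@seq_mod S C f).
Local Notation U := (frob_mult p f c).
Local Notation D := (\sum_(i < c) e i)%N.
Variable tau : S -> Prop.
Hypotheses (tau_ideal : is_ideal tau) (tau_f : forall i, (i < c)%N -> tau (f i))
  (tau_U : frob_power p tau U)
  (tau_min : forall I, is_ideal I -> (forall i, (i < c)%N -> I (f i)) -> frob_power p I U ->
     forall g, tau g -> I g).

Lemma tau_graded E h : tau h -> tau (restrict_deg E h).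
Proof.
have [r [g [eg [gh _ hg _]]]] := tau_generators charp f_homog tau_ideal tau_f tau_U tau_min kfin.
move=> /hg[a ->]; apply/hg.
exists (fun l => restrict_deg (fun j => E (j + eg l)%N) (a l)).
have rD : {morph @restrict_deg k m E : u v / u + v}.
  by move=> u v; apply/mpolyP=> b; rewrite mcoeffD !mcoeff_restrict_deg mcoeffD; case: ifP; rewrite ?addr0.
rewrite (big_morph _ rD (restrict_deg0 k m E)); apply: eq_bigr => l _.
by rewrite (restrict_degM _ _ (gh l)).
Qed.

Lemma tau_primary_injective (z : C) :
  (forall i : 'I_m, exists N, tau ('X_i ^+ N)) -> part (m - c) z = z ->
  degrees_in (fun s => s < - ((m - c) * D)%N%:Z) z ->
  M c (d z) -> bdry_mod d (M c) (phi z) -> bdry_mod d (M c) z.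
Proof.
move=> htau hz hd dz.
have [r [g [eg [gh ge hg gf]]]] :=
  tau_generators charp f_homog tau_ideal tau_f tau_U tau_min kfin.
apply: (@cech_frob_injective k m p charp c f e f_homog e_gt0 f_reg r g eg D gh ge _
  (- ((m - c) * D)%N%:Z)) => //; last by rewrite addNr.
by move=> i; have [N /hg[a ha]] := htau i; exists N, a.
Qed.

Lemma injective_tau_primary :
  (forall (s : int) (z : C), s < - ((m - c) * D)%N%:Z -> part (m - c) z = z ->
     degrees_in (pred1 s) z -> M c (d z) -> bdry_mod d (M c) (phi z) -> bdry_mod d (M c) z) ->
  forall i : 'I_m, exists N, tau ('X_i ^+ N).
Proof.
move=> hinj i.
(* large enough for D - R - m < - (m - c) * D *)
pose R := ((m - c) * D + D).+1.
exists R; apply: contrapT => nR; rewrite mpolyXn in nR.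
have [a [ha hta na]] := inverse_system_nonzero tau_ideal tau_graded nR.
have degR : mdeg (U_(i) *+ R) = R by rewrite mdegMn mdeg1 mul1n.
rewrite degR in ha hta na.
have [|||z [hz hd dz hb nb]] := @cech_frob_kernel k m p charp c f e f_homog e_gt0 f_reg
  R.+1 a (- (R + m)%N%:Z) _ _ _ na.
- by move=> b /ha h; have := h; rewrite mulSn; lia.
- by move=> j hj; apply/hta/tau_f.
- have [q [a0 [b [hb ->]]]] := tau_U; rewrite mulr_suml.
  apply: var_power_ideal_sum => l; have [y ty ->] := hb l.
  by rewrite -mulrA -exprMn; apply/var_power_idealM/(var_power_idealXp charp)/hta.
apply: nb; apply: hinj hd dz hb => //.
by rewrite /R; move: (\sum_(i < c) e i)%N => Q; move: ((m - c) * Q)%N => W; lia.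
Qed.
End TauPrimary.

(** * Cochains modulo J and the local cohomology of S / J *)

Section Transport.
Local Open Scope quotient_scope.
Variables (k : fieldType) (n : nat) (p : nat) (charp : p \in [pchar k]).
Local Notation S := {mpoly k[n.+1]}.
Variable J : idealr S.
Local Notation R := {ideal_quot J}.
Local Notation X := (fun i : 'I_n.+1 => 'X_i : S).
Local Notation Y := (@quot_var k n J).
Local Notation C := (cech X).
Local Notation d := (@cech_d S n.+1 X).
Local Notation part := (@cech_part S n.+1 X).
Local Notation phi := (@cech_frob S n.+1 X p).
Let p_pr : prime p := pcharf_prime charp.
Let p0 : p%:R = 0 :> R := quot_natr0 J charp.

Implicit Types (A B : {set 'I_n.+1}).

Let pr : {rmorphism S -> R} := \pi_R.

Lemma quot_eq0 a : pr a = 0 <-> a \in J.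
Proof.
rewrite -[a in a \in J]subr0 Quotient.idealrBE -(rmorph0 pr).
by split=> [h|/eqP//]; apply/eqP.
Qed.

Let inJ : S -> Prop := fun a => a \in J.
Lemma idealr_is_ideal : is_ideal inJ.
Proof. split; [exact: rpred0 | by move=> a b ha hb; exact: rpredD | by move=> a b; exact: idealMr]. Qed.

Lemma quot_surj (a : R) : exists b, pr b = a.
Proof. by exists (repr a); exact: reprK. Qed.

Lemma xprod_quot A : xprod Y A = pr (xprod X A).
Proof. by rewrite /xprod rmorph_prod. Qed.

Definition loc_quot A (u : loc (xprod X A)) : loc (xprod Y A) :=
  frac _ (pr (repr u).1) (repr u).2.

Lemma loc_quotE A a N : loc_quot (frac (xprod X A) a N) = frac _ (pr a) N.
Proof.
have [L e] := repr_frac (xprod X A) a N; apply/fracP; exists L.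
by rewrite xprod_quot -!rmorphXn -!rmorphM e.
Qed.

Lemma loc_quotD A : {morph @loc_quot A : u v / u + v}.
Proof.
elim/fracW=> a N; elim/fracW=> b K; rewrite fracD !loc_quotE fracD.
by rewrite xprod_quot !(rmorphD, rmorphM, rmorphXn).
Qed.

Lemma loc_quot0 A : loc_quot (0 : loc (xprod X A)) = 0.
Proof. by rewrite -(frac0 _ 0) loc_quotE rmorph0 frac0. Qed.

Lemma loc_quotN A : {morph @loc_quot A : u / - u}.
Proof. by elim/fracW=> a N; rewrite fracN !loc_quotE fracN rmorphN. Qed.

Lemma loc_quotX A : {morph @loc_quot A : u / u ^+ p}.
Proof. by elim/fracW=> a N; rewrite fracX !loc_quotE fracX rmorphXn. Qed.

Lemma loc_quot_res A B (u : loc (xprod X A)) : A \subset B ->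
  loc_quot (cech_res B u) = cech_res B (loc_quot u).
Proof.
move=> sAB; elim/fracW: u => a N; rewrite cech_resE // !loc_quotE cech_resE //.
by rewrite rmorphM rmorphXn (xprod_quot (B :\: A)).
Qed.

Lemma loc_quot_eq0 A (u : loc (xprod X A)) : loc_quot u = 0 <-> loc_ideal inJ u.
Proof.
have idJ := idealr_is_ideal; elim/fracW: u => a N; rewrite loc_quotE loc_idealE //.
rewrite -(frac0 _ N); split=> [/fracP[L]|[L h]].
  rewrite mulr0 xprod_quot -rmorphXn -rmorphM => /quot_eq0; by exists (L + N)%N.
apply/fracP; exists L; rewrite mulr0 xprod_quot -rmorphXn -rmorphM.
by apply/quot_eq0; rewrite addnC exprD -mulrA; exact: idealMr.
Qed.

Definition cech_quot (c : C) : cech Y := [ffun A : {set 'I_n.+1} => loc_quot (c A)].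

Lemma cech_quotE (c : C) A : cech_quot c A = loc_quot (c A). Proof. by rewrite ffunE. Qed.

Lemma cech_quotB : {morph cech_quot : c e / c - e}.
Proof. by move=> c e; apply/ffunP=> A; rewrite !(cech_quotE, ffunE) loc_quotD loc_quotN. Qed.
HB.instance Definition _ := GRing.isZmodMorphism.Build C (cech Y) cech_quot cech_quotB.

Lemma cech_quot_d (c : C) : cech_quot (d c) = cech_d (cech_quot c).
Proof.
apply/ffunP=> B; rewrite cech_quotE cech_dE [RHS]ffunE.
rewrite (big_morph _ (@loc_quotD B) (loc_quot0 B)); apply: eq_bigr => j jB.
rewrite cech_quotE -loc_quot_res ?subD1set // /cech_sign.
rewrite -signr_odd -[in RHS]signr_odd; case: odd; rewrite ?expr0 ?mul1r // !expr1 !mulN1r.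
exact: loc_quotN.
Qed.

Lemma cech_quot_frob (c : C) : cech_quot (phi c) = cech_frob p (cech_quot c).
Proof. by apply/ffunP=> A; rewrite !ffunE loc_quotX. Qed.

Lemma cech_quot_surj (e : cech Y) : exists c, cech_quot c = e.
Proof.
have h A : exists u : loc (xprod X A), loc_quot u = e A.
  by elim/fracW: (e A) => a N; have [b <-] := quot_surj a; exists (frac _ b N); exact: loc_quotE.
exists [ffun A : {set 'I_n.+1} => sval (cid (h A))].
by apply/ffunP=> A; rewrite cech_quotE ffunE; exact: svalP (cid (h A)).
Qed.

Variables (c : nat) (f : nat -> S).
Hypothesis J_chain : forall a, a \in J <-> ideal_chain f c a.
Local Notation M := (@seq_mod S C f).

Lemma cech_quot_eq0 (z : C) : cech_quot z = 0 <-> M c z.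
Proof.
rewrite seq_mod_cechP; split=> [h A|h].
  have /ffunP/(_ A) := h; rewrite cech_quotE ffunE => /loc_quot_eq0[a [N [ha ->]]].
  by exists a, N; split=> //; apply/J_chain.
apply/ffunP=> A; rewrite cech_quotE [RHS]ffunE; apply/loc_quot_eq0.
by have [a [N [ha ->]]] := h A; exists a, N; split=> //; apply/J_chain.
Qed.

Lemma cech_quot_part i (z : C) :
  cech_quot (part i z) =
  [ffun A : {set 'I_n.+1} => if #|A| == i then cech_quot z A else 0].
Proof.
by apply/ffunP=> A; rewrite cech_quotE cech_partE ffunE cech_quotE; case: eqP; rewrite ?loc_quot0.
Qed.

Lemma cech_quot_cocycle i (z : C) : part i z = z -> M c (d z) ->
  cocycle_pred i (cech_quot z).
Proof.
move=> hz dz; apply/andP; split.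
  apply/forallP=> A; apply/implyP=> /negbTE hA.
  by rewrite -hz cech_quot_part ffunE hA.
by apply/eqP; rewrite -cech_quot_d; apply/cech_quot_eq0.
Qed.

(** Projecting a primitive to the Cech degree below that of x gives one of the
    kind that [coboundary] asks for. *)
Lemma cech_quot_coboundary i (x : C) (w : cocycle Y i) : part i x = x ->
  cocycle_val w = cech_quot x -> bdry_mod d (M c) x <-> coboundary w.
Proof.
move=> hx wx; have hM := @seq_mod_submodule S C f c.
split=> [[y hy]|/asboolP[b _ wb]]; last first.
  have [y yb] := cech_quot_surj b; exists y; apply/cech_quot_eq0.
  by rewrite raddfB /= cech_quot_d yb -wx -wb subrr.
apply/asboolP; case: i x w hx wx y hy => [|i] x w hx wx y hy.
  exists 0; first by apply/forallP=> A; apply/implyP=> _; rewrite ffunE.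
  rewrite raddf0 [LHS]wx; apply/cech_quot_eq0.
  have := seq_mod_linear (part 0) hy.
  by rewrite (raddfB (part 0)) /= cech_part0_d subr0 hx.
exists (cech_quot (part i y)).
  apply/forallP=> A; apply/implyP; rewrite eqSS => /negbTE hA.
  by rewrite cech_quot_part ffunE hA.
rewrite [LHS]wx -cech_quot_d; apply/eqP; rewrite -subr_eq0 -raddfB; apply/eqP/cech_quot_eq0.
have := seq_mod_linear (part i.+1) hy.
by rewrite (raddfB (part _)) /= cech_part_d hx.
Qed.

Lemma quot_deg_loc (s : int) A (u : loc (xprod X A)) : loc_restrict (pred1 s) u = u ->
  loc_deg (@quot_deg k n J) s (loc_quot u).
Proof.
move=> <-; elim/fracW: u => a N; rewrite loc_restrictE loc_quotE.
do 2!eexists; split; last by [].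
eexists; last by [].
move: (N * #|A|)%N => q; case sN : (s + q%:Z) => [j|j].
  right; exists j => //; apply: dhomog_restrict => i /= /eqP; lia.
left; apply/mpolyP=> b; rewrite mcoeff_restrict_deg mcoeff0; case: ifP => //= /eqP; lia.
Qed.

Lemma loc_deg_lift (T : pred int) (s : int) A (v : loc (xprod Y A)) : T s ->
  loc_deg (@quot_deg k n J) s v ->
  exists2 u : loc (xprod X A), loc_restrict T u = u & loc_quot u = v.
Proof.
move=> Ts [_ [N [[g hg ->] ->]]]; exists (frac _ g N); last exact: loc_quotE.
rewrite loc_restrictE; congr frac; apply/mpolyP=> b; rewrite mcoeff_restrict_deg.
case: hg => [->|[j hj /dhomogP gj]]; first by rewrite mcoeff0 if_same.
case: ifPn => // hT; apply/esym/memN_msupp_eq0; apply: contra hT => /gj /= ->.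
by rewrite -hj addrK.
Qed.

Lemma coh_lt_lift i (t : int) (h : quot_cohomology J i) : h \in quot_cohomology_lt J i t ->
  exists (z : C) (w : cocycle Y i), [/\ part i z = z, degrees_in (fun s => s < t) z, M c (d z),
     cocycle_val w = cech_quot z & h = coh_class w].
Proof.
move=> /asboolP[r [v [s [hv ->]]]].
have hl l : exists zw : C * cocycle Y i, [/\ part i zw.1 = zw.1, degrees_in (fun s => s < t) zw.1,
     M c (d zw.1), cocycle_val zw.2 = cech_quot zw.1 & v l = coh_class zw.2].
  have [st [w hw ->]] := hv l.
  have hA A := @loc_deg_lift (fun s => s < t) _ A _ st (hw A).
  pose z : C := part i [ffun A : {set 'I_n.+1} => s2val (cid2 (hA A))].
  have zw : cocycle_val w = cech_quot z.
    apply/ffunP=> A; rewrite cech_quot_part ffunE cech_quotE ffunE.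
    have /andP[/forallP/(_ A)/implyP w0 _] := valP w.
    by case: eqP => [_|/eqP/w0/eqP//]; rewrite (s2valP' (cid2 (hA A))).
  exists (z, w); split=> //=.
  - exact: cech_part_id.
  - rewrite /degrees_in cech_restrict_part; congr part; apply/ffunP=> A.
    by rewrite cech_restrictE ffunE (s2valP (cid2 (hA A))).
  apply/cech_quot_eq0; rewrite cech_quot_d -zw.
  by have /andP[_ /eqP] := valP w.
have [zw hzw] := choice hl.
exists (\sum_l (zw l).1), (\sum_l (zw l).2); split.
- by rewrite raddf_sum; apply: eq_bigr => l _; case: (hzw l).
- by rewrite /degrees_in raddf_sum; apply: eq_bigr => l _; case: (hzw l).
- rewrite raddf_sum; apply: submodule_sum; first exact: seq_mod_submodule.
  by move=> l; case: (hzw l).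
- rewrite [LHS](raddf_sum val) raddf_sum; apply: eq_bigr => l _.
  by case: (hzw l).
by rewrite raddf_sum; apply: eq_bigr => l _; case: (hzw l).
Qed.

Lemma quot_frob_injective i (t : int) :
  (forall z : C, part i z = z -> degrees_in (fun s => s < t) z -> M c (d z) ->
     bdry_mod d (M c) (phi z) -> bdry_mod d (M c) z) ->
  injective (quot_frob_lt J charp i t).
Proof.
move=> hz h1 h2 /(congr1 val) /= e; apply: val_inj => /=.
have [z1 [w1 [z1i z1t dz1 w1E h1E]]] := coh_lt_lift (valP h1).
have [z2 [w2 [z2i z2t dz2 w2E h2E]]] := coh_lt_lift (valP h2).
rewrite /= in h1E h2E; rewrite h1E h2E in e *; apply/eqP; rewrite -subr_eq0 -raddfB; apply/eqP/coh_class0P.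
have wE : cocycle_val (w1 - w2) = cech_quot (z1 - z2).
  by rewrite cech_quotB -w1E -w2E.
have zi : part i (z1 - z2) = z1 - z2 by rewrite (raddfB (part i)) /= z1i z2i.
apply/(cech_quot_coboundary zi wE); apply: hz => //.
- exact: degrees_inB.
- rewrite (raddfB d); apply: submoduleB => //; exact: seq_mod_submodule.
have phii : part i (phi (z1 - z2)) = phi (z1 - z2) by rewrite -(cech_frob_part charp) zi.
apply/(cech_quot_coboundary (w := cocycle_frob p_pr p0 (w1 - w2)) phii).
  by rewrite cech_quot_frob -wE.
have eF := cocycle_frobB p_pr p0 w1 w2.
apply/coh_class0P; rewrite eF raddfB /= -!coh_frobE; apply/eqP; rewrite subr_eq0; apply/eqP.
exact: e.
Qed.

Lemma cech_frob_injective_of_quot i (t s : int) (z : C) :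
  injective (quot_frob_lt J charp i t) -> s < t ->
  part i z = z -> degrees_in (pred1 s) z -> M c (d z) ->
  bdry_mod d (M c) (phi z) -> bdry_mod d (M c) z.
Proof.
move=> inj st zi zs dz phiz.
pose w : cocycle Y i := Cocycle (cech_quot_cocycle zi dz).
have hw : coh_class w \in quot_cohomology_lt J i t.
  apply/asboolP; exists 1%N, (fun=> coh_class w), (fun=> s); split; last by rewrite big_ord1.
  move=> _; split=> //; exists w => // A /=; rewrite cech_quotE; apply: quot_deg_loc.
  by rewrite -cech_restrictE zs.
have h0 : (0 : quot_cohomology J i) \in quot_cohomology_lt J i t.
  by apply/asboolP; exists 0%N, (fun=> 0), (fun=> 0); split; [case | rewrite big_ord0].
pose mem h := is_true (h \in quot_cohomology_lt J i t).
have /(congr1 val) /= w0 : exist mem _ hw = exist mem _ h0.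
  apply: inj; apply: val_inj => /=; rewrite raddf0 coh_frobE.
  have phii : part i (phi z) = phi z by rewrite -(cech_frob_part charp) zi.
  apply/coh_class0P/(cech_quot_coboundary phii) => //.
  by rewrite cech_quot_frob.
by apply/(cech_quot_coboundary (w := w) zi) => //; apply/coh_class0P.
Qed.
End Transport.

(** * Isolated non-F-pure points and injectivity of Frobenius *)

Theorem corollary3p4 (k : fieldType) (p : nat) (charp : p \in [pchar k])
    (kfin : finite_over_pth_powers k p)
    (n c : nat) (f : 'I_c -> {mpoly k[n.+1]}) (deg : 'I_c -> nat)
    (deg_gt0 : forall j, (0 < deg j)%N)
    (f_homog : forall j, f j \is (deg j).-homog)
    (f_reg : regular_seq f)
    (J : idealr {mpoly k[n.+1]})
    (J_gen : forall g, g \in J <-> ideal_gen (fun h => exists j, h = f j) g)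
    (tau : {mpoly k[n.+1]} -> Prop)
    (tau_smallest : is_smallest
       (fun I => [/\ is_ideal I, forall g, g \in J -> I g
                   & frob_power p I ((\prod_j f j) ^+ p.-1)]) tau)
    (tau_proper : ~ forall g, tau g) :
  (forall g, radical tau g <-> irrelevant_ideal g) <->
  injective (quot_frob_lt J charp (n.+1 - c)%N
               (- ((n.+1 - c) * \sum_j deg j)%N%:Z)).
Proof.
pose F (i : nat) := oapp f 0 (insub i); pose e (i : nat) := oapp deg 0%N (insub i).
have FE (i : 'I_c) : F i = f i by rewrite /F valK.
have eE (i : 'I_c) : e i = deg i by rewrite /e valK.
have F_homog i : (i < c)%N -> F i \is (e i).-homog.
  by move=> hi; rewrite (FE (Ordinal hi)) (eE (Ordinal hi)).
have e_gt0 i : (i < c)%N -> (0 < e i)%N by move=> hi; rewrite (eE (Ordinal hi)).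
have F_reg i a : (i < c)%N -> ideal_chain F i (F i * a) -> ideal_chain F i a.
  move=> hi; have := f_reg.1 (Ordinal hi) a => /=; rewrite -FE /= [a * _]mulrC.
  have -> : (fun h => exists2 j : 'I_c, (j < i)%N & h = f j) =
            (fun h => exists2 j : nat, (j < i)%N & h = F j).
    apply: funext => h; apply: propext; split=> [[j ji ->]|[j ji ->]].
      by exists j.
    by exists (Ordinal (ltn_trans ji hi)) => //; rewrite -FE.
  by move=> h /ideal_chainP/h/ideal_chainP.
have J_chain g : g \in J <-> ideal_chain F c g.
  rewrite J_gen ideal_chainP.
  have -> // : (fun h => exists j, h = f j) = (fun h => exists2 j : nat, (j < c)%N & h = F j).
  apply: funext => h; apply: propext; split=> [[j ->]|[j jc ->]]; first by exists j.
  by exists (Ordinal jc); rewrite -FE.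
have UE : (\prod_j f j) ^+ p.-1 = frob_mult p F c.
  by rewrite -prodrXl; apply: eq_bigr => i _; rewrite FE.
have dE : (\sum_j deg j = \sum_(i < c) e i)%N by apply: eq_bigr => i _; rewrite eE.
have [[tau_ideal tau_J tau_U] tau_min] := tau_smallest.
rewrite UE in tau_U.
have tau_F i : (i < c)%N -> tau (F i).
  move=> hi; apply: tau_J; apply/J_gen/ideal_gen_sub.
  by exists (Ordinal hi); rewrite -FE.
have tau_min' I : is_ideal I -> (forall i, (i < c)%N -> I (F i)) ->
    frob_power p I (frob_mult p F c) -> forall g, tau g -> I g.
  move=> idI IF IU; apply: tau_min; split=> //; last by rewrite UE.
  by move=> g /J_gen; apply: ideal_gen_min => // _ [j ->]; rewrite -FE; exact: IF.
have graded := tau_graded charp kfin F_homog tau_ideal tau_F tau_U tau_min'.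
rewrite (radical_irrelevantP tau_ideal graded tau_proper) dE; split=> [prim|inj].
  apply: (quot_frob_injective J_chain) => z.
  exact: (tau_primary_injective charp kfin F_homog e_gt0 F_reg tau_ideal tau_F tau_U tau_min').
apply: (injective_tau_primary charp kfin F_homog e_gt0 F_reg tau_ideal tau_F tau_U tau_min').
by move=> s z; exact: (cech_frob_injective_of_quot J_chain inj).
Qed.
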